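(* Let Assumption (A) (see context) hold and let there exist a solution $(\tilde u,\tilde V)$ of $$du=dV-A(u)\,dt$$ (in the sense of the context) on some probability space. If $(\Omega,\mathcal F,\mathbb P)$ is a probability space and $V$ is a $C[0,T;U']$-valued random variable on it with $\mathcal L(V)=\mathcal L(\tilde V)$, then there exists a unique (up to almost sure equality) $\mathbb X_1$-valued random variable $u$ with a $\sigma$-compact range such that $(u,V)$ is a solution of $du=dV-A(u)\,dt$. Moreover, $u$ is $(\mathcal F^{V,0}_t)$-adapted, where $(\mathcal F^{V,0}_t)$ denotes the $\mathbb P$-augmentation of the filtration generated by $V$.
   Context: $U$ is a separable Banach space, $H$ a Hilbert space identified with its dual, the embeddings $U\hookrightarrow H\hookrightarrow U'$ are dense, $(f,v)=f(v)$ denotes the pairing of $U'$ with $U$ (equal to $(f,v)_H$ if $f\in H$), $A:U\to U'$, $T>0$, $1<r<\infty$, and $$\mathbb X_1=C[0,T;U']\cap L^r[0,T;U]_{weak},$$ where $L^r[0,T;U]_{weak}$ is the Bochner space with its weak topology and the intersection carries the coarsest topology making both inclusions continuous. $\mathcal L(X)$ denotes the law of a random variable $X$ on the Borel $\sigma$-algebra of its target space. Assumption (A): if $\lambda>0$ and $u_1,u_2\in C[0,T;U']\cap L^r[0,T;U]$ satisfy $A(u_1),A(u_2)\in L^1[0,T;U']$ and $$(u_2(t)-u_1(t),v)+\int_0^t\lambda\,(A(u_2(s))-A(u_1(s)),v)\,ds=0,\qquad t\in[0,T],\ v\in U,$$ then $u_1=u_2$. (If this holds for some $T>0$ then it holds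 for all $T>0$.) Solution: a pair $(u,V)$ of random variables on a probability space $(\Omega,\mathcal F,\mathbb P)$ with values in $\mathbb X_1\times C[0,T;U']$ is a solution of $du=dV-A(u)\,dt$ if $\mathbb P[u\in S]=1$ for some $\sigma$-compact set $S$ in $\mathbb X_1$, $A(u)\in L^1[0,T;U']$ almost surely, and $$\mathbb P\Big[(u(t),v)=(V(t),v)-\int_0^t(A(u(s)),v)\,ds\Big]=1,\qquad t\in[0,T],\ v\in U.$$
   Formalization: The operator A from U to U' is additionally assumed to be Borel measurable; without this the claim is false (for a non-measurable A on R^2, a V with the same law may admit no solution). *)

(* Defs.v *)
From HB Require Import structures.
From mathcomp Require Import all_boot all_order all_algebra sesquilinear.
From mathcomp Require Import all_classical all_reals all_analysis.
From mathcomp Require Import measurable_realfun generic_quotient ring_quotient ring.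
Set Implicit Arguments. Unset Strict Implicit. Unset Printing Implicit Defensive.
Import Order.TTheory GRing.Theory Num.Theory.
Import numFieldNormedType.Exports.
Local Open Scope classical_set_scope.
Local Open Scope ring_scope.

(* The continuous dual E' of a real normed space, as a normed space: continuous
   linear forms with the operator norm. *)
Section dual.
Context {R : realType} (E : normedModType R).

Definition dual_pred : {pred (E -> R^o)} :=
  mem [set f : E -> R^o | linear f /\ continuous f].

Record dual := Dual { dual_fun :> E -> R^o; dual_funP : dual_fun \in dual_pred }.

HB.instance Definition _ := [isSub for dual_fun].
HB.instance Definition _ := [Choice of dual by <:].

Fact dual_submod_closed : submod_closed dual_pred.
Proof.
split=> [|a f g /set_mem[lf cf] /set_mem[lg cg]]; apply/mem_set; split.
- by move=> b x y; rewrite scaler0 addr0.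
- by move=> x; exact: cvg_cst.
- move=> b x y; rewrite !fctE lf lg !scalerDr addrACA; congr (_ + _ + _).
  by rewrite !scalerA mulrC.
- move=> x; apply: cvgD; last exact: cg.
  by apply: cvgZl_tmp; exact: cf.
Qed.
HB.instance Definition _ :=
  GRing.isSubmodClosed.Build R (E -> R^o) dual_pred dual_submod_closed.
HB.instance Definition _ := [SubChoice_isSubLmodule of dual by <:].

Definition dual_norm (f : dual) : R :=
  sup [set `|f v| | v in [set v : E | `|v| <= 1]].

Lemma dual_linear (f : dual) : linear f.
Proof. by case: (set_mem (dual_funP f)). Qed.
Lemma dual_continuous (f : dual) : continuous f.
Proof. by case: (set_mem (dual_funP f)). Qed.
HB.instance Definition _ (f : dual) :=
  GRing.isLinear.Build R E R^o *:%R (f : E -> R^o) (@dual_linear f).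

Lemma dual_has_sup (f : dual) :
  has_sup [set `|f v| | v in [set v : E | `|v| <= 1]].
Proof.
split; first by exists `|f 0|, 0 => //=; rewrite normr0.
have /linear_bounded_continuous/linear_boundedP[r [_ fr]] := @dual_continuous f.
exists (`|r| + 1) => _ [v /= v1 <-].
rewrite (le_trans (fr (`|r| + 1) _ v))//.
  by rewrite (le_lt_trans (ler_norm r))// ltrDl.
by rewrite ler_piMr// addr_ge0.
Qed.

Lemma dual_norm_ub (f : dual) v : `|v| <= 1 -> `|f v| <= dual_norm f.
Proof.
by move=> v1; apply: ub_le_sup; [exact: (dual_has_sup f).2|exists v].
Qed.

Lemma dual_norm_le (f : dual) b :
  (forall v, `|v| <= 1 -> `|f v| <= b) -> dual_norm f <= b.
Proof.
move=> fb; apply: ge_sup; first exact: (dual_has_sup f).1.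
by move=> _ [v /= v1 <-]; exact: fb.
Qed.

Fact dual_ler_normD (f g : dual) : dual_norm (f + g) <= dual_norm f + dual_norm g.
Proof.
apply: dual_norm_le => v v1; rewrite (le_trans (ler_normD _ _))//.
by rewrite lerD// dual_norm_ub.
Qed.

Fact dual_norm_ge0 (f : dual) : 0 <= dual_norm f.
Proof. by rewrite (le_trans _ (@dual_norm_ub f 0 _)) ?normr0. Qed.

Fact dual_normrZ (a : R) (f : dual) : dual_norm (a *: f) = `|a| * dual_norm f.
Proof.
have le1 b (g : dual) : dual_norm (b *: g) <= `|b| * dual_norm g.
  apply: dual_norm_le => v v1.
  by rewrite [X in `|X|](_ : _ = b * g v)// normrM ler_wpM2l// dual_norm_ub.
apply/eqP; rewrite eq_le le1/=.
have [->|a0] := eqVneq a 0; first by rewrite normr0 mul0r dual_norm_ge0.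
rewrite -{1}[f](scalerK a0) -ler_pdivlMl ?normr_gt0//.
by rewrite (le_trans (le1 _ _))// normfV.
Qed.

Fact dual_normr0_eq0 (f : dual) : dual_norm f = 0 -> f = 0.
Proof.
move=> f0; apply/val_inj/funext => v /=.
have [->|v0] := eqVneq v 0; first by rewrite (linear0 f).
have : `|f (`|v|^-1 *: v)| <= 0.
  rewrite -f0 dual_norm_ub// normrZ normfV normr_id mulVf//.
  by rewrite normr_eq0.
have -> : f (`|v|^-1 *: v) = `|v|^-1 * f v by exact: linearZ.
rewrite normr_le0 mulf_eq0 invr_eq0 normr_eq0 (negbTE v0)/=.
by move/eqP.
Qed.

HB.instance Definition _ := @Lmodule_isNormed.Build R dual
  dual_norm dual_ler_normD dual_normrZ dual_normr0_eq0.
End dual.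

(* T equipped with its Borel sigma-algebra. *)
Definition borel (T : ptopologicalType) := g_sigma_algebraType (@open T).
HB.instance Definition _ (T : ptopologicalType) := Measurable.on (borel T).

(* E with its weak topology: the coarsest one making all elements of E'
   continuous. *)
Section weak.
Context {R : realType} (E : normedModType R).
Definition weak : Type := E.
HB.instance Definition _ := Pointed.on weak.
HB.instance Definition _ := Topological.copy weak
  (sup_topology (fun f : dual E => Topological.class
     (initial_topology (f : E -> R)))).
End weak.

(* C[0,T;X] with the topology of uniform convergence. A path is stored as a
   total function on R that vanishes outside [0,T], so that Leibniz equality is
   equality on [0,T]. *)
Section continuous_paths.
Context {R : realType} (T : R) (X : normedModType R).
Definition cpath_pred : {pred (R -> X)} :=
  mem [set f : R -> X | {within `[0, T], continuous f} /\
                        forall t, t \notin `[0, T] -> f t = 0].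
Record cpath := CPath { cpath_fun :> R -> X ; cpathP : cpath_fun \in cpath_pred }.
HB.instance Definition _ := [isSub for cpath_fun].
HB.instance Definition _ := [Choice of cpath by <:].
Lemma cpath0_subproof : (fun=> 0) \in cpath_pred.
Proof.
by apply/mem_set; split=> //; apply: continuous_subspaceT => ?; exact: cvg_cst.
Qed.
Definition cpath0 := CPath cpath0_subproof.
HB.instance Definition _ := isPointed.Build cpath cpath0.
HB.instance Definition _ := Topological.copy cpath
  (initial_topology (cpath_fun : cpath -> {uniform` `[0, T] -> X})).
End continuous_paths.

(* Bochner spaces L^p(S, mu; X), 1 <= p < oo, of classes modulo mu-almost
   everywhere equality. Representatives are taken strongly measurable, i.e.
   everywhere limits of simple functions; every function that is only almost
   everywhere such a limit is equal almost everywhere to one of these. *)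
Section bochner.
Context d (S : measurableType d) (R : realType) (X : normedModType R).

Definition simple_fun (f : S -> X) :=
  finite_set (range f) /\ forall x, measurable (f @^-1` [set x]).

Definition strongly_measurable (f : S -> X) :=
  exists s : nat -> S -> X, (forall n, simple_fun (s n)) /\
    forall x, s n x @[n --> \oo] --> f x.

Lemma simple_fun_cst x : simple_fun (cst x).
Proof.
split; first by apply: (@sub_finite_set _ _ [set x]) => // _ [? _ <-].
by move=> y; rewrite preimage_cst; case: ifP.
Qed.

Lemma simple_fun_comp2 (h : X -> X -> X) (f g : S -> X) :
  simple_fun f -> simple_fun g -> simple_fun (fun x => h (f x) (g x)).
Proof.
move=> [ff mf] [fg mg]; split.
  apply: (@sub_finite_set _ _ [set h y.1 y.2 | y in range f `*` range g]).
    by move=> _ [x _ <-]; exists (f x, g x) => //=; split; exists x.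
  exact/finite_image/finite_setX.
move=> z.
have -> : (fun x => h (f x) (g x)) @^-1` [set z] =
    \bigcup_(y in (range f `*` range g) `&` [set y | h y.1 y.2 = z])
      (f @^-1` [set y.1] `&` g @^-1` [set y.2]).
  apply/seteqP; split=> [x /= hz|x [[y1 y2] /= [_ <-] [-> ->]]//].
  by exists (f x, g x) => //=; do 2!split => //; exists x.
apply: fin_bigcup_measurable; first exact/finite_setIl/finite_setX.
by move=> y _; apply: measurableI; [exact: mf|exact: mg].
Qed.

Lemma simple_fun_normB (f : S -> X) (c : X) : simple_fun f ->
  measurable_fun setT (fun x => `|f x - c|).
Proof.
move=> [ff mf] _ B mB; rewrite setTI.
have -> : (fun x => `|f x - c|) @^-1` B =
   \bigcup_(y in range f `&` [set y | B `|y - c|]) (f @^-1` [set y]).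
  apply/seteqP; split=> [x /= Bx|x [y [_ By] /= ->]//].
  by exists (f x) => //=; split => //; exists x.
apply: fin_bigcup_measurable; first exact: finite_setIl.
by move=> y _; exact: mf.
Qed.

Lemma strongly_measurable_norm (f : S -> X) :
  strongly_measurable f -> measurable_fun setT (fun x => `|f x|).
Proof.
move=> [s [ss sf]].
apply/measurable_EFinP.
apply: (emeasurable_fun_cvg (fun n x => `|s n x|%:E)) => [n|x _].
  apply/measurable_EFinP; have := simple_fun_normB 0 (ss n).
  by under eq_fun do rewrite subr0.
by apply: cvg_EFin; [exact: nearW|apply: cvg_norm; exact: sf].
Qed.

Lemma strongly_measurable0 : strongly_measurable (cst 0).
Proof.
by exists (fun=> cst 0); split=> [_|x]; [exact: simple_fun_cst|exact: cvg_cst].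
Qed.

Lemma strongly_measurableZD (a : R) (f g : S -> X) :
  strongly_measurable f -> strongly_measurable g ->
  strongly_measurable (fun x => a *: f x + g x).
Proof.
move=> [s [ss sf]] [t [st tg]]; exists (fun n x => a *: s n x + t n x); split.
  by move=> n; exact: (simple_fun_comp2 (fun y z => a *: y + z)).
by move=> x; apply: cvgD; [apply: cvgZl_tmp; exact: sf|exact: tg].
Qed.

Variables (mu : {measure set S -> \bar R}) (p : R).

(* The (extended) real (int |f|^p)^(1/p). *)
Definition Lnorm_vec (f : S -> X) : \bar R :=
  'N[mu]_(p%:E)[EFin \o (fun x => `|f x|%R)]%E.

Definition bochner_pred : {pred (S -> X)} :=
  mem [set f | strongly_measurable f /\ (Lnorm_vec f < +oo)%E].

Record bochner_fun (p1 : 1 <= p) := BochnerFun {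
  bochner_val :> S -> X ; bochnerP : bochner_val \in bochner_pred }.

HB.instance Definition _ (p1 : 1 <= p) := [isSub for @bochner_val p1].
HB.instance Definition _ (p1 : 1 <= p) := [Choice of bochner_fun p1 by <:].

Lemma Lnorm_vec0 (p1 : 1 <= p) : Lnorm_vec (cst 0) = 0%E.
Proof.
rewrite /Lnorm_vec (_ : _ \o _ = cst 0%E).
  by rewrite Lnorm0// eqe gt_eqF// (lt_le_trans _ p1).
by apply/funext => x /=; rewrite normr0.
Qed.

Lemma Lnorm_vecE (f : S -> X) :
  Lnorm_vec f = ((\int[mu]_x (`|f x| `^ p)%:E) `^ p^-1)%E.
Proof.
rewrite /Lnorm_vec unlock; congr (_ `^ _)%E.
by apply: eq_integral => x _ /=; rewrite normr_id.
Qed.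

Lemma le_Lnorm_nneg (p1 : 1 <= p) (g h : S -> R) :
  measurable_fun setT g -> measurable_fun setT h ->
  (forall x, 0 <= g x <= h x) ->
  ('N[mu]_(p%:E)[EFin \o g] <= 'N[mu]_(p%:E)[EFin \o h])%E.
Proof.
move=> mg mh gh; have p0 : 0 <= p by rewrite (le_trans _ p1).
have mpow (k : S -> R) : measurable_fun setT k ->
    measurable_fun setT (fun x => `|(EFin \o k) x| `^ p)%E.
  move=> mk; apply/measurable_EFinP.
  by apply: (@measurableT_comp _ _ _ _ _ _ (@powR R ^~ p)) => //;
    exact: measurableT_comp.
rewrite unlock gt0_ler_poweR ?invr_ge0//.
- by rewrite in_itv/= leey andbT integral_ge0// => x _; exact: poweR_ge0.
- by rewrite in_itv/= leey andbT integral_ge0// => x _; exact: poweR_ge0.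
apply: ge0_le_integral => //; [|exact: mpow|exact: mpow|].
  by move=> x _; exact: poweR_ge0.
move=> x _; have /andP[g0 ghx] := gh x; rewrite /= lee_fin ge0_ler_powR//.
by rewrite !ger0_norm// (le_trans g0).
Qed.

Lemma Lnorm_vecD (p1 : 1 <= p) (f g : S -> X) : strongly_measurable f ->
  strongly_measurable g ->
  (Lnorm_vec (fun x => f x + g x)%R <= Lnorm_vec f + Lnorm_vec g)%E.
Proof.
move=> sf sg; have mf := strongly_measurable_norm sf.
have mg := strongly_measurable_norm sg.
apply: (@le_trans _ _ ('N[mu]_(p%:E)[EFin \o ((fun x => `|f x|) \+ (fun x => `|g x|))%R])%E).
  apply: le_Lnorm_nneg => //.
  - have := strongly_measurableZD 1 sf sg.
    under eq_fun do rewrite scale1r.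
    exact: strongly_measurable_norm.
  - exact: measurable_funD.
  - by move=> x; rewrite normr_ge0/= ler_normD.
exact: eminkowski.
Qed.

Lemma Lnorm_vecZ (p1 : 1 <= p) a (f : S -> X) : strongly_measurable f ->
  (Lnorm_vec (fun x => a *: f x)%R = `|a|%:E * Lnorm_vec f)%E.
Proof.
move=> /strongly_measurable_norm mf; rewrite !Lnorm_vecE.
have p0 : p != 0 by rewrite gt_eqF// (lt_le_trans _ p1).
have mfp : measurable_fun setT (fun x => (`|f x| `^ p)%:E).
  apply/measurable_EFinP.
  exact: (@measurableT_comp _ _ _ _ _ _ (@powR R ^~ p)).
have -> : (\int[mu]_x (`|a *: f x| `^ p)%:E =
           (`|a| `^ p)%:E * \int[mu]_x (`|f x| `^ p)%:E)%E.
  rewrite -ge0_integralZl_EFin ?powR_ge0//.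
  by apply: eq_integral => x _; rewrite normrZ powRM// EFinM.
have : (0 <= \int[mu]_x (`|f x| `^ p)%:E)%E.
  by apply: integral_ge0 => x _; rewrite lee_fin powR_ge0.
move: (\int[mu]_x _)%E => J J0.
by rewrite poweRM ?lee_fin ?powR_ge0// poweR_EFin -powRrM mulfV// powRr1.
Qed.

Lemma Lnorm_vec_eq0 (p1 : 1 <= p) (f : S -> X) : strongly_measurable f ->
  Lnorm_vec f = 0%E <-> f = cst 0 %[ae mu].
Proof.
move=> /strongly_measurable_norm mf.
have p0 : (0 < p) by rewrite (lt_le_trans _ p1).
split=> [/Lnorm_eq0_eq0|f0].
  have : measurable_fun setT (EFin \o (fun x => `|f x|)) by apply/measurable_EFinP.
  move=> /[swap] /[apply]; rewrite lte_fin => /(_ p0).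
  by apply: filterS => x /(_ I)[] /eqP; rewrite normr_eq0 => /eqP.
rewrite Lnorm_vecE.
have -> : (\int[mu]_x (`|f x| `^ p)%:E = 0)%E.
  transitivity (\int[mu]_x `| (`|f x| `^ p)%:E |)%E.
    by apply: eq_integral => x _; rewrite gee0_abs// lee_fin powR_ge0.
  apply/ae_eq_integral_abs => //.
    apply/measurable_EFinP.
    exact: (@measurableT_comp _ _ _ _ _ _ (@powR R ^~ p)).
  apply: filterS f0 => x /(_ I) fx0 _ /=.
  by rewrite fx0/= normr0 powR0// gt_eqF.
by rewrite poweR_EFin powR0// gt_eqF// invr_gt0.
Qed.

Section Lp.
Variable p1 : 1 <= p.

Fact bochner_submod_closed : submod_closed bochner_pred.
Proof.
split=> [|a f g /set_mem[sf lf] /set_mem[sg lg]]; apply/mem_set; split.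
- exact: strongly_measurable0.
- by rewrite -[0]/(cst 0 : S -> X) Lnorm_vec0.
- exact: strongly_measurableZD.
- have sa : strongly_measurable (fun x => a *: f x).
    have := strongly_measurableZD a sf strongly_measurable0.
    by under eq_fun do rewrite addr0.
  apply: le_lt_trans (Lnorm_vecD p1 sa sg) _.
  by rewrite lte_add_pinfty// Lnorm_vecZ// lte_mul_pinfty ?lee_fin.
Qed.
HB.instance Definition _ :=
  GRing.isSubmodClosed.Build R (S -> X) bochner_pred bochner_submod_closed.
HB.instance Definition _ := [SubChoice_isSubLmodule of bochner_fun p1 by <:].

Lemma bochner_strong (f : bochner_fun p1) : strongly_measurable f.
Proof. by case: (set_mem (bochnerP f)). Qed.

Lemma bochner_fin (f : bochner_fun p1) : (Lnorm_vec f < +oo)%E.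
Proof. by case: (set_mem (bochnerP f)). Qed.

Definition ae_null : {pred bochner_fun p1} :=
  mem [set f : bochner_fun p1 | (f : S -> X) = cst 0 %[ae mu]].

Fact ae_null_zmod_closed : zmod_closed ae_null.
Proof.
split=> [|f g /set_mem f0 /set_mem g0]; apply/mem_set.
  exact: aeW.
by apply: filterS2 f0 g0 => x /= f0 g0 _; rewrite [LHS](_ : _ = f x - g x)// f0// g0//= subr0.
Qed.
HB.instance Definition _ :=
  GRing.isZmodClosed.Build (bochner_fun p1) ae_null ae_null_zmod_closed.

Definition Lp : Type := {ideal_quot ae_null}.
HB.instance Definition _ := GRing.Zmodule.on Lp.

(* The class of a function, and a representative of a class. *)
Definition Lp_class (f : bochner_fun p1) : Lp := \pi_({ideal_quot ae_null})%qT f.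
Definition Lp_repr (u : Lp) : bochner_fun p1 := repr (u : {ideal_quot ae_null}).

Lemma Lp_reprK : cancel Lp_repr Lp_class.
Proof. exact: reprK. Qed.

Lemma Lp_classD (f g : bochner_fun p1) :
  Lp_class (f + g) = Lp_class f + Lp_class g.
Proof. by rewrite /Lp_class raddfD. Qed.

Lemma Lp_class_eqP (f g : bochner_fun p1) :
  Lp_class f = Lp_class g <-> (f : S -> X) = g %[ae mu].
Proof.
have -> : (Lp_class f = Lp_class g) <-> (f - g \in ae_null).
  rewrite Quotient.idealrBE; by split=> [fg|/eqP //]; apply/eqP; exact: fg.
split=> [/set_mem|fg].
  apply: filterS => x /(_ I) fg _; apply/eqP; rewrite -subr_eq0; apply/eqP/fg.
apply/mem_set; apply: filterS fg => x /(_ I) fg _.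
by rewrite [LHS](_ : _ = f x - g x)// fg subrr.
Qed.

Lemma Lp_classK (f : bochner_fun p1) : (Lp_repr (Lp_class f) : S -> X) = f %[ae mu].
Proof. by apply/Lp_class_eqP; rewrite Lp_reprK. Qed.

Lemma Lp_classN (f : bochner_fun p1) : Lp_class (- f) = - Lp_class f.
Proof. by rewrite /Lp_class raddfN. Qed.

Definition Lp_scale (a : R) (u : Lp) : Lp := Lp_class (a *: Lp_repr u).

Lemma Lp_scale_class a (f : bochner_fun p1) :
  Lp_scale a (Lp_class f) = Lp_class (a *: f).
Proof.
apply/Lp_class_eqP; apply: filterS (Lp_classK f) => x /(_ I) fx _.
by rewrite [LHS](_ : _ = a *: Lp_repr (Lp_class f) x)// fx.
Qed.

Fact Lp_scalerA a b (u : Lp) :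
  Lp_scale a (Lp_scale b u) = Lp_scale (a * b) u.
Proof. by rewrite -[u]Lp_reprK !Lp_scale_class scalerA. Qed.

Fact Lp_scale1r : left_id 1 Lp_scale.
Proof. by move=> u; rewrite -[u]Lp_reprK !Lp_scale_class scale1r. Qed.

Fact Lp_scalerDr : right_distributive Lp_scale +%R.
Proof.
move=> a u v; rewrite -[u]Lp_reprK -[v]Lp_reprK.
by rewrite -Lp_classD !Lp_scale_class scalerDr Lp_classD.
Qed.

Fact Lp_scalerDl (u : Lp) : {morph Lp_scale^~ u : a b / a + b}.
Proof.
move=> a b; rewrite -[u]Lp_reprK.
by rewrite !Lp_scale_class scalerDl Lp_classD.
Qed.

HB.instance Definition _ := GRing.Zmodule_isLmodule.Build R Lp
  Lp_scalerA Lp_scale1r Lp_scalerDr Lp_scalerDl.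

Lemma Lp_classZ a (f : bochner_fun p1) : Lp_class (a *: f) = a *: Lp_class f.
Proof. by rewrite -Lp_scale_class. Qed.

Definition Lp_norm (u : Lp) : R := fine (Lnorm_vec (Lp_repr u)).

Lemma Lnorm_vec_fineK (f : bochner_fun p1) :
  (fine (Lnorm_vec f))%:E = Lnorm_vec f.
Proof.
by rewrite fineK// ge0_fin_numE ?bochner_fin// Lnorm_ge0.
Qed.

Lemma Lp_norm_class (f : bochner_fun p1) :
  Lp_norm (Lp_class f) = fine (Lnorm_vec f).
Proof.
rewrite /Lp_norm; congr fine; rewrite !Lnorm_vecE; congr (_ `^ _)%E.
have mp (g : bochner_fun p1) : measurable_fun setT (fun x => (`|g x| `^ p)%:E).
  apply/measurable_EFinP/(@measurableT_comp _ _ _ _ _ _ (@powR R ^~ p)) => //.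
  exact/strongly_measurable_norm/bochner_strong.
apply: ae_eq_integral => //; apply: filterS (Lp_classK f) => x /(_ I) fx _.
by rewrite fx.
Qed.

Fact Lp_ler_normD (u v : Lp) : Lp_norm (u + v) <= Lp_norm u + Lp_norm v.
Proof.
rewrite -[u]Lp_reprK -[v]Lp_reprK -Lp_classD !Lp_norm_class -lee_fin EFinD.
by rewrite !Lnorm_vec_fineK Lnorm_vecD//; exact: bochner_strong.
Qed.

Fact Lp_normrZ (a : R) (u : Lp) : Lp_norm (a *: u) = `|a| * Lp_norm u.
Proof.
rewrite -[u]Lp_reprK -Lp_classZ !Lp_norm_class; apply: EFin_inj.
by rewrite EFinM !Lnorm_vec_fineK Lnorm_vecZ//; exact: bochner_strong.
Qed.

Fact Lp_normr0_eq0 (u : Lp) : Lp_norm u = 0 -> u = 0.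
Proof.
move=> h; have u0 : Lnorm_vec (Lp_repr u) = 0%E.
  by rewrite -Lnorm_vec_fineK -[fine _]/(Lp_norm u) h.
rewrite -[u]Lp_reprK; have -> : 0 = Lp_class 0 by rewrite /Lp_class raddf0.
apply/Lp_class_eqP.
exact: (Lnorm_vec_eq0 p1 (bochner_strong (Lp_repr u))).1 u0.
Qed.

HB.instance Definition _ := @Lmodule_isNormed.Build R Lp
  Lp_norm Lp_ler_normD Lp_normrZ Lp_normr0_eq0.
End Lp.
End bochner.

Definition separable_space (T : topologicalType) :=
  exists D : set T, countable D /\ dense D.

Section gelfand.
Context {R : realType} (U H : completeNormedModType R).

(* With the completeness of H, this makes H a real Hilbert space. *)
Record inner_product := InnerProduct {
  ip_form :> {dot H for idfun} ;
  ip_norm : forall x : H, ip_form x x = `|x| ^+ 2 }.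

Record dense_embedding := DenseEmbedding {
  emb_fun :> {linear U -> H} ;
  emb_continuous : continuous emb_fun ;
  emb_inj : injective emb_fun ;
  emb_dense : dense (range emb_fun) }.

Variables (ip : inner_product) (j : dense_embedding).

Fact pairing_in_dual (h : H) : (fun v : U => ip h (j v)) \in @dual_pred R U.
Proof.
have lip : linear (fun v : U => ip h (j v) : R^o).
  by move=> a x y; rewrite linearP linearDr linearZr_LR.
apply/mem_set; split => //.
have -> : (fun v : U => ip h (j v)) =
    (fun v => 2^-1 * (`|h + j v| * `|h + j v| - `|h| * `|h| - `|j v| * `|j v|)).
  apply/funext => v.
  have ipDl x y z : ip (x + y) z = ip x z + ip y z by exact: linearDl.
  have ipDr x y z : ip z (x + y) = ip z x + ip z y by exact: linearDr.
  have ipC x y : ip x y = ip y x.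
    by have := @hermC R false idfun H ip x y; rewrite expr0 mul1r.
  have ipD : ip (h + j v) (h + j v) =
      ip h h + ip h (j v) + (ip h (j v) + ip (j v) (j v)).
    by rewrite ipDl !ipDr (ipC (j v) h).
  by rewrite -!expr2 -!(ip_norm ip) ipD; field.
move=> v.
have jv : j x @[x --> v] --> j v by exact: emb_continuous.
apply: cvgM; first exact: cvg_cst.
apply: cvgB; first (apply: cvgB; last exact: cvg_cst).
  by apply: cvgM; apply: cvg_norm; apply: cvgD => //; exact: cvg_cst.
by apply: cvgM; exact: cvg_norm.
Qed.

(* The embedding of H into U' obtained by identifying H with H':
   (h, v) := (h, j v)_H for v in U. *)
Definition H_to_dual (h : H) : dual U := Dual (pairing_in_dual h).
End gelfand.

Section solution_space.
Context {R : realType} {U H : completeNormedModType R}.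
Variables (ip : inner_product H) (j : dense_embedding U H).
Variables (T r : R) (r1 : 1 < r).

(* Lebesgue measure on [0,T]. *)
Definition leb_itv : {measure set (measurableTypeR R) -> \bar R} :=
  mrestr lebesgue_measure (measurable_itv `[0, T]).

(* The intersection C[0,T;U'] /\ L^r[0,T;U] is the set of pairs (c, l) such that
   c = l almost everywhere on [0,T] under the embeddings U -> H -> U'. Since
   these are injective each component determines the other, and X1_C and X1_L
   are the two inclusions. *)
Definition X1_pred : {pred cpath T (dual U) * Lp U leb_itv (ltW r1)} :=
  mem [set cl : cpath T (dual U) * Lp U leb_itv (ltW r1) |
    \forall t \ae leb_itv, cl.1 t = H_to_dual ip j (j (Lp_repr cl.2 t))].

Record X1 := MkX1 {
  X1_val : cpath T (dual U) * Lp U leb_itv (ltW r1) ;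
  X1P : X1_val \in X1_pred }.
HB.instance Definition _ := [isSub for X1_val].
HB.instance Definition _ := [Choice of X1 by <:].

Definition X1_C (u : X1) : cpath T (dual U) := (X1_val u).1.
Definition X1_L (u : X1) : weak (Lp U leb_itv (ltW r1)) := (X1_val u).2.
(* A U-valued representative of u in L^r[0,T;U], for evaluating A(u(t)). *)
Definition X1_path (u : X1) : R -> U := Lp_repr (X1_L u).

Fact X1_0_subproof : (point, 0) \in X1_pred.
Proof.
apply/mem_set; have := Lp_classK (0 : bochner_fun U leb_itv (ltW r1)).
apply: filterS => t /(_ I) /= t0.
rewrite [X in Lp_repr X](_ : _ = Lp_class 0); last by rewrite /Lp_class raddf0.
rewrite t0; apply/val_inj/funext => v /=.
by rewrite [j _]linear0; symmetry; exact: (linear0l ip).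
Qed.
HB.instance Definition _ := isPointed.Build X1 (MkX1 X1_0_subproof).

HB.instance Definition _ := Topological.copy X1
  (sup_topology (fun b : bool =>
    if b then Topological.class (initial_topology X1_C) : Topological X1
    else Topological.class (initial_topology X1_L))).

Definition sigma_compact (S : set X1) :=
  exists K : nat -> set X1, (forall n, compact (K n)) /\ S = \bigcup_n K n.

(* f belongs to L^1[0,T;U'], as a function defined almost everywhere. *)
Definition in_L1 (f : R -> dual U) :=
  exists w : Lp (dual U) leb_itv (lexx 1), \forall t \ae leb_itv, f t = Lp_repr w t.

Definition assumptionA (A : U -> dual U) :=
  forall (lambda : R) (u1 u2 : X1), 0 < lambda ->
    in_L1 (A \o X1_path u1) -> in_L1 (A \o X1_path u2) ->
    (forall (t : R) (v : U), t \in `[0, T] ->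
      (X1_C u2 t - X1_C u1 t) v +
      \int[lebesgue_measure]_(s in `[0, t])
        (lambda * (A (X1_path u2 s) - A (X1_path u1 s)) v) = 0) ->
    u1 = u2.

Definition is_solution (A : U -> dual U) d (Omega : measurableType d)
    (P : probability Omega R)
    (u : {RV P >-> borel X1}) (V : {RV P >-> borel (cpath T (dual U))}) :=
  [/\ exists S, sigma_compact S /\ {ae P, forall w, S (u w)},
      {ae P, forall w, in_L1 (A \o X1_path (u w))} &
      forall (t : R) (v : U), t \in `[0, T] ->
        {ae P, forall w, X1_C (u w) t v = (V w : cpath T (dual U)) t v -
          \int[lebesgue_measure]_(s in `[0, t]) (A (X1_path (u w) s) v)}].

(* The P-augmentation of the filtration generated by V. *)
Definition augmented_filtration d (Omega : measurableType d)
    (P : probability Omega R) (V : {RV P >-> borel (cpath T (dual U))})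
    (t : R) : set_system Omega :=
  <<s \bigcup_(s in `[0, t]%classic) preimage_set_system setT
        (fun w => (V w : cpath T (dual U)) s : borel (dual U)) measurable
      `|` [set N | measurable N /\ P N = 0%E] >>.

Definition adapted d (Omega : measurableType d) (F : R -> set_system Omega)
    (u : Omega -> X1) :=
  forall t, t \in `[0, T] -> forall B : set (borel (dual U)), measurable B ->
    F t ((fun w => X1_C (u w) t : borel (dual U)) @^-1` B).

Definition sigma_compact_range Omega (u : Omega -> X1) :=
  exists S, sigma_compact S /\ range u `<=` S.
End solution_space.

(* Main.v *)
Require Import Defs.
From HB Require Import structures.
From mathcomp Require Import all_boot all_order all_algebra sesquilinear.
From mathcomp Require Import all_classical all_reals all_analysis.
From mathcomp Require Import measurable_realfun ring lra.
Set Implicit Arguments. Unset Strict Implicit. Unset Printing Implicit Defensive.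
Import Order.TTheory GRing.Theory Num.Theory.
Import numFieldNormedType.Exports.
Local Open Scope classical_set_scope.
Local Open Scope ring_scope.

(* By Assumption (A), a solution path is determined by its driving path, so u must
   be a function of V.  Let M be the set of pairs (x, y) such that x solves the
   equation driven by y, where y is recorded through its values
   (y(t q_k), c_k) at countably many times and vectors.  The recorded y is a Borel
   function of x in X_1: the weak topology of L^r makes local L^1-norms lower
   semicontinuous (Hahn-Banach), so Lebesgue differentiation yields a version of
   (t, x) -> x(t) in U that is jointly Borel, and Fubini applies to the integrals of
   A(x).  Hence M is Borel over each compact K in X_1, and, compacts of X_1 having
   closed sets with F_sigma complements, the law of the given solution is carried
   by countably many closed subsets F_i of M lying over compacts.  Projections
   along a compact factor are closed, so the inverse of the projection of U_i F_i
   to the y-coordinate, which is a function by uniqueness, is Borel; composing it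
   with V gives u.  Rescaling time turns (A) on [0, T], with factor lambda = t / T,
   into uniqueness on [0, t]; the same construction with samples in [0, t] then
   shows that u(t) is almost surely a function of V on [0, t]. *)

(** * Hahn-Banach theorem *)

(** The weak topology of L^r need not be metrizable, so theorems on Borel injections between Polish
    spaces are out of reach; moreover the Borel sets of X1 * R^N may exceed the product
    sigma-algebra, so a pair of Borel maps need not be Borel. What remains is compactness together
    with a countable family of continuous functions that separate points. Regularity of the law is
    therefore proved only through closed sets whose preimages are measurable ([mclosed]), and over
    one compact at a time. Drivers enter through samples in R^N because a closed set there is cut
    out by countably many conditions on finitely many coordinates each; one argument then gives
    measurability both for the Borel sigma-algebra and for the augmented filtration. Equality of
    laws enters only through one kind of event: the set of drivers reached by the F_i is Borel in
    path space, so its full measure passes from [V'] to [V]. *)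

Section hahn_banach.
Context {R : realType} {E : lmodType R}.
Implicit Types (p q : E -> R) (x y : E).

(** Only [<=] is asked under scaling, which infima inherit at once; equality follows by scaling back
    with [a^-1]. *)
Definition sublinear q :=
  (forall x y, q (x + y) <= q x + q y) /\
  (forall a x, 0 < a -> q (a *: x) <= a * q x).

Lemma sublinearZ q a x : sublinear q -> 0 < a -> q (a *: x) = a * q x.
Proof.
move=> [_ qZ] a0; apply/eqP; rewrite eq_le qZ//=.
rewrite -ler_pdivlMl// (le_trans _ (qZ _ _ _)) ?invr_gt0//.
by rewrite scalerA mulVf ?gt_eqF// scale1r.
Qed.

Lemma sublinear0 q : sublinear q -> q 0 = 0.
Proof.
move=> qs; have := @sublinearZ q 2 0 qs ltac:(lra).
by rewrite scaler0; lra.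
Qed.

Lemma sublinear_ge q x : sublinear q -> - q (- x) <= q x.
Proof.
move=> qs; have := qs.1 x (- x); rewrite subrr sublinear0//; lra.
Qed.

(* The best lower bound of [q] that forces linearity along the direction [y]. *)
Definition straighten q y x :=
  inf [set q (x + t *: y) - t * q y | t in [set t | 0 <= t]].

Lemma straighten_has_inf q y x : sublinear q ->
  has_inf [set q (x + t *: y) - t * q y | t in [set t : R | 0 <= t]].
Proof.
move=> qs; split; first by exists (q (x + 0 *: y) - 0 * q y), 0 => /=.
exists (- q (- x)) => _ [t /= t0 <-].
have := qs.1 (x + t *: y) (- x); rewrite addrAC subrr add0r.
have [->|tn0] := eqVneq t 0.
  by rewrite scale0r sublinear0//; lra.
by rewrite sublinearZ ?lt0r ?tn0//; lra.
Qed.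

Lemma straighten_le q y x t : sublinear q -> 0 <= t ->
  straighten q y x <= q (x + t *: y) - t * q y.
Proof.
move=> qs t0; apply: ge_inf; first exact: (straighten_has_inf _ _ qs).2.
by exists t.
Qed.

Lemma le_straighten q y x b : sublinear q ->
  (forall t, 0 <= t -> b <= q (x + t *: y) - t * q y) -> b <= straighten q y x.
Proof.
move=> qs qb; apply: lb_le_inf; first exact: (straighten_has_inf _ _ qs).1.
by move=> _ [t t0 <-]; exact: qb.
Qed.

Lemma straighten_le_self q y x : sublinear q -> straighten q y x <= q x.
Proof.
move=> qs; rewrite (le_trans (straighten_le _ _ qs (lexx 0)))//.
by rewrite scale0r addr0 mul0r subr0.
Qed.

Lemma straighten_sublinear q y : sublinear q -> sublinear (straighten q y).
Proof.
move=> qs; split=> [x x'|a x a0].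
  rewrite -lerBlDl; apply: le_straighten => // t t0.
  rewrite lerBlDl -lerBlDr; apply: le_straighten => // s s0.
  rewrite lerBlDr (le_trans (straighten_le _ _ qs (addr_ge0 s0 t0)))//.
  rewrite scalerDl addrACA.
  by have := qs.1 (x + s *: y) (x' + t *: y); lra.
rewrite -ler_pdivrMl//; apply: le_straighten => // t t0.
rewrite ler_pdivrMl// (le_trans (straighten_le _ _ qs (mulr_ge0 (ltW a0) t0)))//.
by rewrite -scalerA -scalerDr sublinearZ// mulrBr mulrA.
Qed.

(* A minimal sublinear functional coincides with each of its straightenings,
   hence is linear. *)
Lemma hahn_banach p x0 : sublinear p ->
  exists f : E -> R^o, [/\ linear f, forall x, f x <= p x & f x0 = p x0].
Proof.
(* Minimizing below [p'] instead of [p] gives the last clause: [p' (- x0) <= p 0 - p x0], so a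
   linear [m] below [p'] satisfies [p x0 <= m x0]. *)
move=> ps; pose p' := straighten p x0.
have p's : sublinear p' by exact: straighten_sublinear.
pose D := {q : E -> R | sublinear q /\ forall x, q x <= p' x}.
(* The order is reversed: a maximal element for [r] is a minimal functional. *)
pose r (s t : D) := `[< forall x, sval t x <= sval s x >].
have r_anti (s t : D) : r s t -> r t s -> s = t.
  case: s t => s sP [t tP] /asboolP/= st /asboolP/= ts; apply: eq_exist.
  by apply/funext => x; apply/eqP; rewrite eq_le ts st.
have [| | |m mmin] := @Zorn D r _ _ r_anti.
- by move=> t; apply/asboolP.
- move=> a b c /asboolP ab /asboolP bc; apply/asboolP => x.
  by rewrite (le_trans (bc x)).
- move=> A totA; have [[s0 As0]|A0] := pselect (exists s, A s); last first.
    have p'D : sublinear p' /\ forall x, p' x <= p' x by [].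
    by exists (exist _ p' p'D) => s As; case: A0; exists s.
  pose t x := inf [set sval s x | s in A].
  have hi x : has_inf [set sval s x | s in A].
    split; first by exists (sval s0 x), s0.
    exists (- p' (- x)) => _ [s As <-].
    rewrite (le_trans _ (sublinear_ge x (svalP s).1))// lerN2.
    exact: (svalP s).2.
  have tle s x : A s -> t x <= sval s x.
    by move=> As; apply: ge_inf; [exact: (hi x).2|exists s].
  have tge x b : (forall s, A s -> b <= sval s x) -> b <= t x.
    move=> h; apply: lb_le_inf; first exact: (hi x).1.
    by move=> _ [s As <-]; exact: h.
  have tD : sublinear t /\ forall x, t x <= p' x.
    split; last first.
      by move=> x; rewrite (le_trans (tle s0 x As0))//; exact: (svalP s0).2.
    split=> [x y|a x a0].
      rewrite -lerBlDl; apply: (tge) => s As.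
      rewrite lerBlDl -lerBlDr; apply: (tge) => s' As'.
      rewrite lerBlDr.
      (* Of the two members of the chain, the smaller one bounds [t (x + y)] and serves both
         points. *)
      have [/asboolP ss'|/asboolP ss'] := totA _ _ As As'.
        rewrite (le_trans (tle s' _ As'))// (le_trans ((svalP s').1.1 _ _))//.
        by rewrite lerD2l.
      rewrite (le_trans (tle s _ As))// (le_trans ((svalP s).1.1 _ _))//.
      by rewrite lerD2r.
    rewrite -ler_pdivrMl//; apply: (tge) => s As.
    by rewrite ler_pdivrMl// (le_trans (tle s _ As))// (svalP s).1.2.
  by exists (exist _ t tD) => s As; apply/asboolP => x /=; exact: tle.
case: m mmin => m [ms mp'] mmin.
have mst y x : straighten m y x = m x.
  have yD : sublinear (straighten m y) /\ forall x, straighten m y x <= p' x.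
    split; first exact: straighten_sublinear.
    by move=> z; rewrite (le_trans (straighten_le_self _ _ ms)).
  have /mmin/(congr1 sval)/= -> // : r (exist _ m (conj ms mp')) (exist _ _ yD).
  by apply/asboolP => z /=; exact: straighten_le_self.
have mD x y : m (x + y) = m x + m y.
  apply/eqP; rewrite eq_le ms.1/=.
  have := straighten_le y x ms ler01; rewrite mst scale1r mul1r; lra.
have mN x : m (- x) = - m x.
  by have := mD x (- x); rewrite subrr sublinear0//; lra.
have mZ a x : m (a *: x) = a * m x.
  have [a0|a0|->] := ltgtP a 0; last by rewrite scale0r mul0r sublinear0.
  - rewrite -[a]opprK scaleNr mN sublinearZ// ?oppr_gt0//; lra.
  - exact: sublinearZ.
have p'p x : p' x <= p x by exact: straighten_le_self.
have mp x : m x <= p x by rewrite (le_trans (mp' x)).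
exists m; split => //; first by move=> a x y; rewrite mD mZ.
apply/eqP; rewrite eq_le mp/=.
have := le_trans (mp' (- x0)) (straighten_le x0 (- x0) ps ler01).
rewrite scale1r mul1r addNr sublinear0// mN; lra.
Qed.

End hahn_banach.

(** * Inner approximation by closed sets *)

Lemma preimage_setD {aT rT : Type} (f : aT -> rT) (A B : set rT) :
  f @^-1` (A `\` B) = f @^-1` A `\` f @^-1` B.
Proof. by []. Qed.

Section closed_approximation.
Context d (Omega : measurableType d) (R : realType) (P : probability Omega R).
Context (Z : topologicalType) (zeta : Omega -> Z) (D : set Z).

(** When [zeta] is a pair of Borel maps, a closed set of the product need not have a measurable
    preimage, so measurability is demanded separately. *)
Definition mclosed (F : set Z) := closed F /\ measurable (zeta @^-1` F).

Definition sandwiched (B : set Z) := forall e : R, 0 < e ->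
  exists F1 F2, [/\ mclosed F1, mclosed F2, F1 `<=` B, F2 `<=` ~` B &
    (P (zeta @^-1` (D `\` (F1 `|` F2))) <= e%:E)%E].

Lemma mclosed0 : mclosed set0.
Proof. by split; [exact: closed0|rewrite preimage_set0]. Qed.

Lemma mclosedT : mclosed setT.
Proof. by split; [exact: closedT|rewrite preimage_setT]. Qed.

Lemma mclosed_bigI (F : nat -> set Z) :
  (forall n, mclosed (F n)) -> mclosed (\bigcap_n F n).
Proof.
move=> mF; split; first by apply: closed_bigI => n _; exact: (mF n).1.
by rewrite preimage_bigcap; apply: bigcapT_measurable => n; exact: (mF n).2.
Qed.

Lemma mclosed_bigsetU (F : nat -> set Z) N :
  (forall n, mclosed (F n)) -> mclosed (\big[setU/set0]_(i < N) F i).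
Proof.
move=> mF; elim: N => [|N [cN mN]]; first by rewrite big_ord0; exact: mclosed0.
rewrite big_ord_recr/=; split; first by apply: closedU => //; exact: (mF N).1.
by rewrite preimage_setU; apply: measurableU => //; exact: (mF N).2.
Qed.

Hypothesis mD : measurable (zeta @^-1` D).

Lemma measurable_gap F1 F2 : mclosed F1 -> mclosed F2 ->
  measurable (zeta @^-1` (D `\` (F1 `|` F2))).
Proof.
move=> [_ m1] [_ m2]; rewrite preimage_setD preimage_setU.
by apply: measurableD => //; exact: measurableU.
Qed.

(** A countable union is cut at a finite stage to keep its inner part closed; the inner parts of the
    complements are intersected, which keeps them closed without any cut. *)
Lemma sandwiched_sigma_algebra : sigma_algebra setT sandwiched.
Proof.
split.
- move=> e e0; exists set0, setT; split => //; [exact: mclosed0|exact: mclosedT|by move=> ? _ []|].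
  by rewrite setUT setDT preimage_set0 measure0 lee_fin ltW.
- move=> B sB e /sB[F1 [F2 [mF1 mF2 FB FBC PF]]]; exists F2, F1; split => //.
  + by rewrite setTD.
  + by rewrite setTD setCK.
  + by rewrite setUC.
move=> B sB e e0.
(* One half of [e] pays for the gaps, in portions [e / 2 / 2 ^ n.+1]; the other half pays for the
   cut at [N]. *)
have e20 : 0 < e / 2 by rewrite divr_gt0.
have /choice[F1 /choice[F2 hF]] : forall n, exists F1 F2, [/\ mclosed F1,
    mclosed F2, F1 `<=` B n, F2 `<=` ~` B n &
    (P (zeta @^-1` (D `\` (F1 `|` F2))) <= (e / 2 / (2 ^ n.+1)%:R)%:E)%E].
  by move=> n; apply: sB; rewrite divr_gt0// ltr0n expn_gt0.
have m1 n : mclosed (F1 n) by case: (hF n).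
have m2 n : mclosed (F2 n) by case: (hF n).
pose U := \bigcup_n F1 n.
pose C N := zeta @^-1` (U `\` \big[setU/set0]_(i < N) F1 i).
have mU : measurable (zeta @^-1` U).
  by rewrite preimage_bigcup; apply: bigcup_measurable => n _; exact: (m1 n).2.
have mC N : measurable (C N).
  by rewrite /C preimage_setD; apply: measurableD => //; exact: (mclosed_bigsetU N m1).2.
have C0 : \bigcap_N C N = set0.
  apply/seteqP; split => // w wC.
  have [[n _ Fn] _] := wC 0%N I.
  have [_] := wC n.+1 I; apply.
  by rewrite -bigcup_mkord; exists n => /=.
have : (P \o C) x @[x --> \oo] --> P (\bigcap_N C N).
  apply: nonincreasing_cvg_mu => //.
  - by rewrite (le_lt_trans (probability_le1 _ _))// ltry.
  - by rewrite C0.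
  - move=> n m nm; apply/subsetPset => w [Uw nF]; split => //.
    apply: contra_not nF; rewrite -!bigcup_mkord => -[i /= im Fi].
    by exists i => //=; exact: leq_trans nm.
rewrite C0 measure0 => /fine_cvgP[_].
move=> /cvgrPdist_le/(_ _ e20)[N _ /(_ N (leqnn N))] /=.
rewrite sub0r normrN ger0_norm ?fine_ge0// => PN.
exists (\big[setU/set0]_(i < N) F1 i), (\bigcap_n F2 n); split.
- exact: mclosed_bigsetU.
- exact: mclosed_bigI.
- rewrite -bigcup_mkord => z [n _ Fz]; exists n => //.
  by case: (hF n) => _ _ + _ _; apply.
- move=> z Fz [n _ Bz].
  by case: (hF n) => _ _ _ + _ => /(_ z (Fz n I)).
pose G n := zeta @^-1` (D `\` (F1 n `|` F2 n)).
have mG n : measurable (G n) by exact: measurable_gap.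
apply: (@le_trans _ _ (P (\bigcup_n G n `|` C N))).
  apply: le_measure; rewrite ?inE.
  - by apply: measurable_gap; [exact: mclosed_bigsetU|exact: mclosed_bigI].
  - by apply: measurableU => //; exact: bigcup_measurable.
  move=> w [Dw nF]; have [FU|nFU] := pselect (U (zeta w)).
    by right; split => // FN; apply: nF; left.
  have [n nF2] : exists n, ~ F2 n (zeta w).
    by apply/existsNP => F2w; apply: nF; right => n _; exact: F2w.
  by left; exists n => //; split => // -[F1w|//]; apply: nFU; exists n.
apply: (le_trans (measureU2 _ _ _)) => //; first exact: bigcup_measurable.
rewrite [e]splitr EFinD leeD//; last first.
  by rewrite -[leLHS]fineK ?lee_fin// fin_num_measure.
have mUG : measurable (\bigcup_n G n) by exact: bigcup_measurable.
apply: (le_trans (measure_sigma_subadditive P mG mUG (@subset_refl _ _))).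
apply: (@le_trans _ _ (\sum_(0 <= i <oo) (e / 2 / (2 ^ i.+1)%:R)%:E)%E); last first.
  exact: (epsilon_trick0 xpredT (ltW e20)).
apply: lee_nneseries => n *; first exact: measure_ge0.
by case: (hF n).
Qed.

(** [B] approximates itself, and finite unions of the [G n] exhaust its complement over [D] by
    continuity from above. *)
Lemma sandwiched_closed B (G : nat -> set Z) : mclosed B ->
  (forall n, mclosed (G n)) -> (forall n, G n `<=` ~` B) ->
  D `\` B `<=` \bigcup_n G n -> sandwiched B.
Proof.
move=> mB mG GB DG e e0.
pose C N := zeta @^-1` (D `\` (B `|` \big[setU/set0]_(i < N) G i)).
have mC N : measurable (C N).
  by apply: measurable_gap => //; exact: mclosed_bigsetU.
have C0 : \bigcap_N C N = set0.
  apply/seteqP; split => // w wC.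
  have [Dw nBw] := wC 0%N I.
  have [n _ Gn] : (\bigcup_n G n) (zeta w).
    by apply: DG; split => // Bw; apply: nBw; left.
  have [_] := wC n.+1 I; apply; right.
  by rewrite -bigcup_mkord; exists n => /=.
have : (P \o C) x @[x --> \oo] --> P (\bigcap_N C N).
  apply: nonincreasing_cvg_mu => //.
  - by rewrite (le_lt_trans (probability_le1 _ _))// ltry.
  - by rewrite C0.
  - move=> n m nm; apply/subsetPset => w [Dw nF]; split => //.
    apply: contra_not nF => -[|]; first by left.
    rewrite -!bigcup_mkord => -[i /= im Fi].
    by right; exists i => //=; exact: leq_trans nm.
rewrite C0 measure0 => /fine_cvgP[_].
move=> /cvgrPdist_le/(_ _ e0)[N _ /(_ N (leqnn N))] /=.
rewrite sub0r normrN ger0_norm ?fine_ge0// => PN.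
exists B, (\big[setU/set0]_(i < N) G i); split => //.
- exact: mclosed_bigsetU.
- by rewrite -bigcup_mkord => z [n _ Gz]; exact: (GB n).
by rewrite -/(C N) -[leLHS]fineK ?lee_fin// fin_num_measure.
Qed.

Lemma sandwiched_inner B : sandwiched B -> exists F : nat -> set Z,
  [/\ forall n, closed (F n), forall n, F n `<=` B &
      {ae P, forall w, D (zeta w) -> B (zeta w) -> exists n, F n (zeta w)}].
Proof.
move=> sB.
have /choice[F1 /choice[F2 hF]] : forall n, exists F1 F2, [/\ mclosed F1,
    mclosed F2, F1 `<=` B, F2 `<=` ~` B &
    (P (zeta @^-1` (D `\` (F1 `|` F2))) <= (n.+1%:R^-1)%:E)%E].
  by move=> n; apply: sB; rewrite invr_gt0.
exists F1; split => [n|n|]; [by case: (hF n) => -[]|by case: (hF n)|].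
(* A point of [B] over [D] missed by every [F1 n] lies in all these gaps, whose measures tend to
   0. *)
pose G n := zeta @^-1` (D `\` (F1 n `|` F2 n)).
have mG n : measurable (G n) by case: (hF n) => *; exact: measurable_gap.
exists (\bigcap_n G n); split; first exact: bigcapT_measurable.
- apply/eqP; rewrite eq_le measure_ge0 andbT; apply/lee_addgt0Pr => e e0.
  rewrite add0e.
  have [n ne] : exists n, n.+1%:R^-1 <= e :> R.
    have /ltW := archi_boundP (ltW (divr_gt0 ltr01 e0)).
    move: (Num.bound _) => n en; exists n.
    rewrite -[leRHS]invrK lef_pV2 ?posrE ?invr_gt0//.
    by rewrite -div1r (le_trans en)// ler_nat.
  apply: (@le_trans _ _ (P (G n))).
    apply: le_measure; rewrite ?inE//; first exact: bigcapT_measurable.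
    by apply: bigcap_inf.
  by case: (hF n) => _ _ _ _ /le_trans; apply; rewrite lee_fin.
move=> w /= /not_implyP[Dw] /not_implyP[Bw nF] n _.
split => // -[F1w|F2w]; first by apply: nF; exists n.
by case: (hF n) => _ _ _ + _ => /(_ _ F2w).
Qed.

End closed_approximation.

(** Tube lemma: the near-covering form of compactness yields one neighbourhood of [y] that avoids
    [F] over all of [K]. *)
Lemma compact_projection (X Y : topologicalType) (K : set X) (F : set (X * Y)) :
  compact K -> closed F -> closed [set y | exists2 x, K x & F (x, y)].
Proof.
move=> /compact_near_coveringP cK cF; rewrite -openC openE => y nFy.
suff : \forall y' \near nbhs y, K `<=` (fun x => ~ F (x, y')).
  by apply: filterS => y' KF [x Kx]; exact: KF.
apply: cK => x Kx.
have : nbhs (x, y) (~` F).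
  by apply: open_nbhs_nbhs; split; [rewrite openC|move=> Fxy; apply: nFy; exists x].
by apply: filterS => -[].
Qed.

Section separating_functions.
Context {R : realType} {X : topologicalType} (phi : nat -> X -> R).
Hypothesis phi_cts : forall k, continuous (phi k).
Hypothesis phi_sep : forall x y, (forall k, phi k x = phi k y) -> x = y.

Lemma separating_hausdorff : hausdorff_space X.
Proof.
move=> x y xy; apply: phi_sep => k; apply: (@Rhausdorff R) => A B nA nB.
have [z [Az Bz]] := xy _ _ (phi_cts nA) (phi_cts nB).
by exists (phi k z).
Qed.

(* [G n] collects the points of [K] whose first [n] coordinates stay at distance
   at least [1 / n.+1] from those of [K `&` Q]. *)
Lemma compact_setD_Fsigma (K Q : set X) : compact K -> closed Q ->
  exists G : nat -> set X, [/\ forall n, closed (G n), forall n, G n `<=` ~` Q &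
    K `\` Q `<=` \bigcup_n G n].
Proof.
move=> cK cQ; have clK : closed K := compact_closed separating_hausdorff cK.
(* Only the first [n] functions occur, so [L n q] is a finite union of closed sets. *)
pose L n q := \big[setU/set0]_(k < n) [set z | n.+1%:R^-1 <= `|phi k z - phi k q|].
have LP n q z : L n q z <-> exists2 k, (k < n)%N & n.+1%:R^-1 <= `|phi k z - phi k q|.
  rewrite /L -(bigcup_mkord n (fun k => [set z | n.+1%:R^-1 <= `|phi k z - phi k q|])).
  by split=> [[k]|[k]]; exists k.
have cL n q : closed (L n q).
  rewrite /L; elim/big_ind: _ => [|A B|k _]; [exact: closed0|exact: closedU|].
  apply: (@preimage_closed _ _ (fun z => `|phi k z - phi k q|) [set r | n.+1%:R^-1 <= r]).
    by move=> z _; apply: cvg_norm; apply: cvgB; [exact: phi_cts|exact: cvg_cst].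
  exact: closed_ge.
pose G n := K `&` \bigcap_(q in K `&` Q) L n q.
exists G; split.
- by move=> n; apply: closedI => //; apply: closed_bigI => q _.
- move=> n z [Kz Lz] Qz; have /LP[k kn] := Lz z (conj Kz Qz).
  by rewrite subrr normr0; apply/negP; rewrite -ltNge invr_gt0.
move=> z [Kz nQz].
have cKQ : compact (K `&` Q).
  by apply: subclosed_compact cK _; [exact: closedI|apply: subIsetl].
(* Compactness makes a single index serve all points of [K] that lie in [Q]. *)
suff [N _ NL] : \forall n \near \oo, (K `&` Q) `<=` (fun q => L n q z).
  by exists N => //; split => // q KQq; exact: NL (leqnn N) _ _.
move/compact_near_coveringP : cKQ; apply => q [Kq Qq].
have [k kzq] : exists k, phi k z <> phi k q.
  by apply/existsNP => h; apply: nQz; rewrite (phi_sep h).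
pose e := `|phi k z - phi k q|.
have e0 : 0 < e by rewrite normr_gt0 subr_eq0; exact/eqP.
have e20 : 0 < e / 2 by rewrite divr_gt0.
have h1 : \forall q' \near q, `|phi k q - phi k q'| < e / 2.
  by apply: (@cvgr_dist_lt _ R^o _ (nbhs q) _ (phi k) (phi k q)) => //; exact: phi_cts.
have h2 : \forall n \near \oo, (k < n)%N /\ n.+1%:R^-1 < e / 2.
  by apply: filterI; [exact: nbhs_infty_gt|exact: near_infty_natSinv_lt (PosNum e20)].
exists ([set q' | `|phi k q - phi k q'| < e / 2],
  [set n | (k < n)%N /\ n.+1%:R^-1 < e / 2]) => // -[q' n]/= [qq' [kn ne]].
apply/LP; exists k => //.
have : e <= `|phi k z - phi k q'| + `|phi k q' - phi k q|.
  by rewrite /e -[phi k z - phi k q](subrKA (phi k q')) ler_normD.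
rewrite (distrC (phi k q')) => eab; rewrite ltW// (lt_le_trans ne)//.
move: eab qq'; clearbody e; lra.
Qed.

End separating_functions.

(** [S] is an arbitrary sigma-algebra, not that of a measurable type, so that the augmented
    filtration is covered too. *)
Lemma closed_ptws_measurable {R : realType} (Omega : Type)
    (S : set_system Omega) (eta : Omega -> nat -> R) :
  sigma_algebra setT S ->
  (forall k a b, S [set w | a < eta w k < b]) ->
  forall L : set {ptws nat -> R}, closed L -> S (eta @^-1` L).
Proof.
move=> sS mS L cL.
have SC A : S A -> S (~` A) by case: sS => _ + _ => /(_ A); rewrite setTD.
have SU (A : nat -> set Omega) : (forall n, S (A n)) -> S (\bigcup_n A n).
  by case: sS => _ _; exact.
have S0 : S set0 by case: sS.
have ST : S setT by rewrite -setC0; exact: SC.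
have SI A B : S A -> S B -> S (A `&` B).
  move=> SA SB; rewrite -[A `&` B]setCK setCI; apply: (SC).
  rewrite -bigcup2E; apply: (SU) => -[|[|n]]; rewrite /bigcup2/=.
  - exact: SC.
  - exact: SC.
  - exact: S0.
(* rational cylinders form a countable base *)
pose cyl (n : nat) (c : seq rat) : set (nat -> R) :=
  [set y | forall k, (k < n)%N ->
     ratr (nth 0 c k) - n.+1%:R^-1 < y k < ratr (nth 0 c k) + n.+1%:R^-1].
have Scyl n c : S (eta @^-1` cyl n c).
  have -> : eta @^-1` cyl n c = \big[setI/setT]_(k < n) [set w |
     ratr (nth 0 c k) - n.+1%:R^-1 < eta w k < ratr (nth 0 c k) + n.+1%:R^-1].
    rewrite -(bigcap_mkord n (fun k => [set w |
      ratr (nth 0 c k) - n.+1%:R^-1 < eta w k < ratr (nth 0 c k) + n.+1%:R^-1])).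
    by apply/seteqP; split=> w /= h k; exact: h.
  by elim/big_ind: _ => // k _; exact: mS.
rewrite -[_ @^-1` _]setCK; apply: (SC).
pose good (i : nat) : set Omega :=
  match unpickle i with
  | Some (n, c) => if `[< cyl n c `<=` ~` L >] then eta @^-1` cyl n c else set0
  | None => set0 end.
suff -> : ~` (eta @^-1` L) = \bigcup_i good i.
  apply: (SU) => i; rewrite /good; case: unpickle => [[n c]|//].
  by case: ifP.
apply/seteqP; split=> [w nLw|w [i _]]; last first.
  rewrite /good; case: unpickle => [[n c]|//].
  by case: asboolP => // + Lw => /(_ _ Lw).
have oL : open (~` L) by rewrite openC.
(* If every such box met [L], points [y N] of [L] in them would converge to [eta w] coordinatewise.
   The factor 2 leaves room for rational centres: a cylinder of radius [N.+1%:R^-1] containing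
   [eta w] stays inside the box. *)
have [N hN] : exists N, forall y : nat -> R,
    (forall k, (k < N)%N -> `|eta w k - y k| < 2 * N.+1%:R^-1) -> ~ L y.
  have [] := pselect (exists N, forall y : nat -> R,
    (forall k, (k < N)%N -> `|eta w k - y k| < 2 * N.+1%:R^-1) -> ~ L y) => //.
  move=> /forallNP bad.
  have /choice[y yP] : forall N, exists y : nat -> R,
      (forall k, (k < N)%N -> `|eta w k - y k| < 2 * N.+1%:R^-1) /\ L y.
    move=> N; have /existsNP[y /not_implyP[yN /contrapT Ly]] := bad N.
    by exists y.
  have : (y : nat -> {ptws nat -> R}) @ \oo --> (eta w : {ptws nat -> R}).
    apply/cvg_sup => k; apply/cvg_image; first by apply/seteqP; split=> // r _; exists (fun=> r).
    apply: (@cvg_trans _ ((fun N => y N k) @ \oo)).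
      move=> A yA; exists [set f : nat -> R | A (f k)] => //.
      by apply/seteqP; split=> [_ [f Af <-]//|a Aa]; exists (fun=> a).
    apply/(@cvgrPdist_lt _ R^o) => e e0; near=> N.
    have kN : (k < N)%N by near: N; exact: nbhs_infty_gt.
    rewrite (lt_le_trans ((yP N).1 _ kN))// -ler_pdivlMl// mulrC ltW//.
    by near: N; exact: near_infty_natSinv_lt (PosNum (divr_gt0 e0 (ltr0Sn _ 1))).
  move=> /(_ _ (open_nbhs_nbhs (conj oL nLw)))[N _ /(_ N (leqnn N))] /=.
  by move/(_ (yP N).2).
have N0 : 0 < N.+1%:R^-1 :> R by rewrite invr_gt0.
have /choice[c cP] : forall k, exists q : rat,
    eta w k - N.+1%:R^-1 < ratr q < eta w k + N.+1%:R^-1.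
  move=> k; have /rat_in_itvoo[q] : eta w k - N.+1%:R^-1 < eta w k + N.+1%:R^-1.
    by rewrite ltrD2l gtrN.
  by rewrite in_itv/=; exists q.
exists (pickle (N, mkseq c N)) => //; rewrite /good pickleK.
case: asboolP => [_ k kN|[]].
  rewrite nth_mkseq//; have := cP k; move: (N.+1%:R^-1) => a /andP[? ?].
  by apply/andP; split; lra.
move=> y yc; apply: hN => k kN.
have := cP k; have := yc k kN; rewrite nth_mkseq// ltr_norml.
by move: (N.+1%:R^-1) => a /andP[? ?] /andP[? ?]; apply/andP; split; lra.
Unshelve. all: by end_near. Qed.

Lemma open_borel (T : ptopologicalType) (O : set T) :
  open O -> measurable (O : set (borel T)).
Proof. by move=> oO; exact: sub_sigma_algebra. Qed.

Lemma closed_borel (T : ptopologicalType) (C : set T) :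
  closed C -> measurable (C : set (borel T)).
Proof.
by move=> cC; rewrite -[C]setCK; apply: measurableC; apply: open_borel; rewrite openC.
Qed.

Lemma measurable_fun_borel d (S : measurableType d) (T : ptopologicalType)
    (f : S -> borel T) :
  (forall C : set T, closed C -> measurable (f @^-1` C)) -> measurable_fun setT f.
Proof.
move=> fC; apply: (measurability (@open T : set (set (borel T)))) => //.
move=> _ [V oV <-]; rewrite setTI -[V]setCK -preimage_setC.
by apply: measurableC; apply: fC; rewrite closedC.
Qed.

(** * Closed approximation of graphs over compact sets *)

Section graph_approximation.
Context d (Omega : measurableType d) (R : realType) (P : probability Omega R).
Context (X : ptopologicalType) (phi : nat -> X -> R).
Hypothesis phi_cts : forall k, continuous (phi k).
Hypothesis phi_sep : forall x y, (forall k, phi k x = phi k y) -> x = y.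
Context (xi : Omega -> borel X) (eta : Omega -> {ptws nat -> R}).
Hypothesis mxi : measurable_fun setT xi.
Hypothesis meta : forall k, measurable_fun setT (fun w => (eta w : nat -> R) k).

Let Z := (X * {ptws nat -> R})%type.
Let zeta (w : Omega) : Z := (xi w, eta w).

Lemma mclosed_fst (Q : set X) : closed Q -> mclosed zeta (fst @^-1` Q).
Proof.
move=> cQ; split.
  by apply: preimage_closed cQ => z _; exact: cvg_fst.
by rewrite -[_ @^-1` _]setTI; exact: mxi measurableT _ (closed_borel cQ).
Qed.

Lemma ptws_proj_continuous k : continuous (fun z : Z => (z.2 : nat -> R) k).
Proof.
move=> z; apply: (@continuous_comp _ _ _ snd (fun y : {ptws nat -> R} => (y : nat -> R) k)).
  exact: cvg_snd.
exact: (@proj_continuous nat (fun=> R) k).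
Qed.

Lemma mclosed_coord k (Q : set R) : closed Q ->
  mclosed zeta [set z : Z | Q ((z.2 : nat -> R) k)].
Proof.
move=> cQ; split.
  by apply: preimage_closed cQ => z _; exact: ptws_proj_continuous.
rewrite -[_ @^-1` _]setTI; apply: (meta k measurableT).
exact: closed_measurable.
Qed.

Section one_compact.
Variable K : set X.
Hypothesis cK : compact K.
Let D : set Z := fst @^-1` K.
Let Sa := sandwiched P zeta D.

Let mD : measurable (zeta @^-1` D).
Proof.
apply: (mclosed_fst _).2; apply: compact_closed => //.
exact: separating_hausdorff phi_cts phi_sep.
Qed.

(** With the sandwiched sets as sigma-algebra, ordinary measurability lemmas show that a graph is
    sandwiched. *)
Let Zm := g_sigma_algebraType Sa.

Lemma measurable_sandwiched (B : set Zm) : measurable B -> Sa B.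
Proof.
have := measurable_g_measurableTypeE (sandwiched_sigma_algebra P mD).
by move=> ->.
Qed.

(** Compactness of [K] enters here: over [K], the complement of a closed set is a countable union of
    closed sets. *)
Lemma sandwiched_fst : measurable_fun setT (fst : Zm -> borel X).
Proof.
apply: measurable_fun_borel => C cC; apply: sub_sigma_algebra.
have [G [cG GC KG]] := compact_setD_Fsigma phi_cts phi_sep cK cC.
apply: (@sandwiched_closed _ _ _ _ _ _ _ mD _ (fun n => fst @^-1` G n)).
- exact: mclosed_fst.
- by move=> n; exact: mclosed_fst.
- by move=> n z /=; exact: GC.
- by move=> z [Kz Cz]; have [n _ Gz] := KG _ (conj Kz Cz); exists n.
Qed.

Lemma sandwiched_coord k :
  measurable_fun setT (fun z : Zm => (z.2 : nat -> R) k).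
Proof.
apply: (measurability _ (RGenCInfty.measurableE R)).
move=> _ [_ [a ->] <-]; rewrite setTI; apply: sub_sigma_algebra.
apply: (@sandwiched_closed _ _ _ _ _ _ _ mD _
  (fun n => [set z : Z | (z.2 : nat -> R) k <= a - n.+1%:R^-1])).
- apply: (@mclosed_coord k `[a, +oo[); exact: interval_closed.
- by move=> n; apply: (@mclosed_coord k [set x | x <= _]); exact: closed_le.
- move=> n z /=; rewrite in_itv/= andbT => za; apply/negP; rewrite -ltNge.
  by rewrite (le_lt_trans za)// ltrBlDr ltrDl invr_gt0.
move=> z [_ /=]; rewrite in_itv/= andbT => /negP; rewrite -ltNge => za.
have [N _ /(_ N (leqnn N))] := near_infty_natSinv_lt (PosNum (etrans (subr_gt0 _ _) za)).
by move=> /= /ltW Na; exists N => //=; rewrite lerBrDr -lerBrDl.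
Qed.

Lemma graph_inner (B : set (borel X)) (a : nat -> borel X -> R) :
  measurable B -> (forall k, measurable_fun setT (a k)) ->
  let M := [set z : Z | B z.1 /\ forall k, (z.2 : nat -> R) k = a k z.1] in
  exists F : nat -> set Z,
    [/\ forall n, closed (F n), forall n, F n `<=` M `&` D &
        {ae P, forall w, D (zeta w) -> M (zeta w) -> exists n, F n (zeta w)}].
Proof.
move=> mB ma M.
have /measurable_sandwiched SM : measurable (M : set Zm).
  have -> : M = (fst : Zm -> borel X) @^-1` B `&` \bigcap_k
      ((fun z : Zm => (z.2 : nat -> R) k - a k z.1) @^-1` [set 0]).
    apply/seteqP; split=> z [Bz h]; split => // k.
      by move=> _ /=; rewrite h subrr.
    by apply/eqP; rewrite -subr_eq0; apply/eqP; exact: (h k I).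
  apply: measurableI.
    by rewrite -[X in measurable X]setTI; exact: sandwiched_fst.
  apply: bigcapT_measurable => k; rewrite -[X in measurable X]setTI.
  apply: (@measurable_funB _ _ _ setT) => //; first exact: sandwiched_coord.
  exact: (measurableT_comp (ma k) sandwiched_fst).
have [F [cF FM FP]] := sandwiched_inner mD SM.
exists (fun n => F n `&` D); split.
- move=> n; apply: closedI => //; apply: (mclosed_fst _).1; apply: compact_closed => //.
  exact: separating_hausdorff phi_cts phi_sep.
- by move=> n z [/FM].
by apply: filterS FP => w h Dw Mw; have [n Fn] := h Dw Mw; exists n.
Qed.

End one_compact.

(* The graph of [a] over [B] carries the law of [(xi, eta)]; it is exhausted up
   to a null set by closed sets lying over compacts. *)
Lemma graph_exhaustion (K : nat -> set X) (B : set (borel X))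
    (a : nat -> borel X -> R) :
  (forall n, compact (K n)) -> measurable B ->
  (forall k, measurable_fun setT (a k)) ->
  {ae P, forall w, [/\ exists n, K n (xi w), B (xi w) &
                       forall k, (eta w : nat -> R) k = a k (xi w)]} ->
  exists F : nat -> set Z, [/\ forall n, closed (F n),
    forall n z, F n z -> B z.1 /\ forall k, (z.2 : nat -> R) k = a k z.1,
    forall n, exists m, F n `<=` fst @^-1` K m &
    {ae P, forall w, exists n, F n (xi w, eta w)}].
Proof.
move=> cK mB ma aeM.
have /choice[F hF] := fun n => graph_inner (cK n) mB ma.
exists (fun i => if unpickle i is Some (n, m) then F n m else set0); split.
- by move=> i; case: unpickle => [[n m]|]; [case: (hF n)|exact: closed0].
- by move=> i z; case: unpickle => [[n m]|//]; case: (hF n) => _ /(_ m) + _ => /[apply] -[].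
- move=> i; case: unpickle => [[n m]|]; last by exists 0%N.
  by exists n; case: (hF n) => _ /(_ m) + _ => /subset_trans; apply; exact: subIsetr.
have : {ae P, forall w, forall n, K n (xi w) ->
    (B (xi w) /\ forall k, (eta w : nat -> R) k = a k (xi w)) ->
    exists m, F n m (xi w, eta w)}.
  by apply/ae_foralln => n; case: (hF n).
apply: filterS2 aeM => w [[n Kn] Bw aw] h.
have [m Fm] := h n Kn (conj Bw aw).
by exists (pickle (n, m)); rewrite pickleK.
Qed.

End graph_approximation.

(** * Borel maps into normed spaces *)

Lemma continuous_measurable_borel {R : realType} {X : ptopologicalType} (g : X -> R) :
  continuous g ->
  measurable_fun setT (g : borel X -> R).
Proof.
move=> /continuousP cg; apply: (measurability _ (RGenOpens.measurableE R)).
move=> _ [_ [a [b ->]] <-]; rewrite setTI.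
by apply: open_borel; apply: cg; exact: interval_open.
Qed.

Section borel_normed.
Context {R : realType} {E : normedModType R} {d} {S : measurableType d}.
Implicit Types f : S -> E.

Lemma borel_measurable_normB f c : measurable_fun setT (f : S -> borel E) ->
  measurable_fun setT (fun x => `|f x - c|).
Proof.
move=> mf; apply: (@measurableT_comp _ _ _ _ _ _ (fun y : borel E => `|(y : E) - c|)) => //.
apply: continuous_measurable_borel => y; apply: cvg_norm.
by apply: cvgB; [exact: cvg_id|exact: cvg_cst].
Qed.

Lemma borel_measurable_norm f : measurable_fun setT (f : S -> borel E) ->
  measurable_fun setT (fun x => `|f x|).
Proof.
by move=> /(borel_measurable_normB 0); under eq_fun do rewrite subr0.
Qed.

(** A limit lies in the closed set [C] exactly when, for each [i], the sequence is eventually in the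
    open [i.+1%:R^-1]-neighbourhood of [C]. *)
Lemma borel_measurable_lim (h : nat -> S -> E) f :
  (forall n, measurable_fun setT (h n : S -> borel E)) ->
  (forall x, h n x @[n --> \oo] --> f x) ->
  measurable_fun setT (f : S -> borel E).
Proof.
move=> mh hf; apply: measurable_fun_borel => C cC.
pose V i : set E := \bigcup_(c in C) ball c i.+1%:R^-1.
have oV i : open (V i) by apply: bigcup_open => c _; exact: ball_open.
have -> : f @^-1` C = \bigcap_i \bigcup_N \bigcap_n (h (N + n)%N @^-1` V i).
  apply/seteqP; split=> x /= fx.
    move=> i _; have i0 : 0 < i.+1%:R^-1 :> R by rewrite invr_gt0.
    have /cvgrPdist_lt/(_ _ i0)[N _ hN] := hf x.
    exists N => // n _; exists (f x) => //.
    by rewrite -ball_normE/=; apply: hN => /=; exact: leq_addr.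
  apply: cC => B; rewrite -nbhs_ballE => -[e/= e0 eB].
  have e20 : 0 < e / 2 by rewrite divr_gt0.
  have [i _ /(_ i (leqnn i))/= ie] := near_infty_natSinv_lt (PosNum e20).
  have [N _ hN] := fx i I.
  have /cvgrPdist_lt/(_ _ e20)[M _ hM] := hf x.
  have [c Cc hc] := hN M I; exists c; split => //; apply: eB.
  rewrite -ball_normE/= -[f x](subrK (h (N + M)%N x)) -addrA.
  rewrite (le_lt_trans (ler_normD _ _))// [e]splitr ltrD//.
    by apply: hM => /=; exact: leq_addl.
  by rewrite distrC; move: hc; rewrite -ball_normE/= => /lt_trans; apply.
apply: bigcapT_measurable => i; apply: bigcupT_measurable => N.
apply: bigcapT_measurable => n; rewrite -[X in measurable X]setTI.
by apply: mh => //; exact: open_borel.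
Qed.

Lemma simple_fun_borel f : simple_fun f -> measurable_fun setT (f : S -> borel E).
Proof.
move=> [ff mf] _ B mB; rewrite setTI.
have -> : f @^-1` B = \bigcup_(y in range f `&` B) (f @^-1` [set y]).
  apply/seteqP; split=> [x /= Bx|x [y [_ By] /= ->]//].
  by exists (f x) => //=; split => //; exists x.
apply: fin_bigcup_measurable; first exact: finite_setIl.
by move=> y _; exact: mf.
Qed.

Lemma strongly_measurable_borel f : strongly_measurable f ->
  measurable_fun setT (f : S -> borel E).
Proof.
move=> [s [ss sf]]; apply: borel_measurable_lim sf => n.
exact: simple_fun_borel.
Qed.

Lemma separable_seq : separable_space E ->
  exists c : nat -> E, forall x e, 0 < e -> exists k, `|x - c k| < e.
Proof.
move=> [D [cD dD]].
have D0 : D !=set0.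
  by have [|x [_ Dx]] := dD setT _ openT; [exists 0|exists x].
have [d0 Dd0] := D0; have /countable_injP[g ginj] := cD.
pose c n := xget d0 [set x | D x /\ g x = n].
have cE : D = range c.
  apply/seteqP; split=> [x Dx|_ [n _ <-]]; last first.
    by rewrite /c; case: xgetP => // x _ [].
  exists (g x) => //; rewrite /c; case: xgetP => [y _ [Dy gyx]|/(_ x)[]//].
  by apply: ginj; rewrite ?inE.
exists c => x e e0.
have [||y [yx]] := dD (ball x e).
- by exists x; exact: ballxx.
- exact: ball_open.
by rewrite cE => -[k _ cky]; exists k; rewrite cky; move: yx; rewrite -ball_normE.
Qed.

Lemma borel_strongly_measurable f : separable_space E ->
  measurable_fun setT (f : S -> borel E) -> strongly_measurable f.
Proof.
move=> /separable_seq[c cP] mf.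
(* [s n x] is a point nearest to [f x] among 0 and the [c m] with [m < n]; on a tie the older one is
   kept. *)
pose fix s n x {struct n} := if n is m.+1 then
  if `|f x - c m| < `|f x - s m x| then c m else s m x else 0.
have ss n : simple_fun (s n) /\ measurable_fun setT (fun x => `|f x - s n x|).
  elim: n => [|n [[fs ms] mn]].
    split; first exact: simple_fun_cst.
    by under eq_fun do rewrite subr0; exact: borel_measurable_norm.
  have mc : measurable_fun setT (fun x => `|f x - c n|) by exact: borel_measurable_normB.
  have mlt : measurable [set x | `|f x - c n| < `|f x - s n x|].
    by rewrite -[X in measurable X]setTI;
      exact: (measurable_fun_ltr mc mn measurableT (Y := [set true])).
  split; last first.
    rewrite (_ : (fun x => _) = (fun x => Num.min `|f x - c n| `|f x - s n x|)).
      exact: measurable_minr.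
    by apply/funext => x /=; rewrite /Num.min; case: ifP.
  split.
    apply: (@sub_finite_set _ _ (range (s n) `|` [set c n])); last first.
      by rewrite finite_setU; split.
    move=> _ [x _ <-] /=; case: ifP => _; [by right|by left; exists x].
  move=> y.
  have -> : s n.+1 @^-1` [set y] =
      ([set x | `|f x - c n| < `|f x - s n x|] `&` (cst (c n) @^-1` [set y])) `|`
      (~` [set x | `|f x - c n| < `|f x - s n x|] `&` (s n @^-1` [set y])).
    apply/seteqP; split=> [x /=|x /=].
      by case: ifPn => [? ?|/negP ? ?]; [left|right].
    by case=> -[]; [move=> ->|move=> /negP/negbTE ->].
  apply: measurableU; apply: measurableI => //; last exact: measurableC.
  by rewrite preimage_cst; case: ifP.
exists s; split=> [n|x]; first exact: (ss n).1.
have sle n k : (k < n)%N -> `|f x - s n x| <= `|f x - c k|.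
  elim: n => // n IH; rewrite ltnS leq_eqVlt => /predU1P[->|kn] /=.
    by case: ifPn => //; rewrite -leNgt.
  case: ifPn => [/ltW /le_trans|_]; last exact: IH.
  by apply; exact: IH.
apply/cvgrPdist_lt => e e0; have [k ke] := cP (f x) e e0.
by exists k.+1 => // n /= kn; rewrite (le_lt_trans (sle n k kn)).
Qed.

End borel_normed.

(** * The dual space and the Gelfand embedding *)

Section dual_facts.
Context {R : realType} {U : normedModType R}.
Implicit Types f g : dual U.

Lemma dualB f g v : (f - g) v = f v - g v. Proof. by []. Qed.

Lemma dual_bound f v : `|f v| <= `|f| * `|v|.
Proof.
have [->|v0] := eqVneq v 0; first by rewrite (linear0 f) !normr0 mulr0.
rewrite -ler_pdivrMr ?normr_gt0//.
have := @dual_norm_ub R U f (`|v|^-1 *: v).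
have -> : f (`|v|^-1 *: v) = `|v|^-1 * f v by exact: linearZ.
rewrite !normrM normfV normr_id (mulrC _ `|f v|); apply.
by rewrite normrZ normfV normr_id mulVf ?normr_eq0.
Qed.

Lemma dual_ev_continuous v : continuous (fun f : dual U => f v).
Proof.
move=> f; apply/(@cvgrPdist_le R R^o (dual U) (nbhs f) _ (fun f : dual U => f v) (f v)) => e e0.
have v1 : 0 < `|v| + 1 by rewrite ltr_wpDl.
have ev0 : 0 < e / (`|v| + 1) by rewrite divr_gt0.
apply: filterS (nbhsx_ballx f _ ev0) => g; rewrite -ball_normE/= => /ltW.
rewrite ler_pdivlMr// => fg.
rewrite -dualB (le_trans (dual_bound _ _))// (le_trans _ fg)//.
by rewrite ler_wpM2l// lerDl.
Qed.

End dual_facts.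

Section gelfand_facts.
Context {R : realType} {U H : completeNormedModType R}.
Variables (ip : inner_product H) (j : dense_embedding U H).

Let ipDl x y z : ip (x + y) z = ip x z + ip y z.
Proof. exact: linearDl. Qed.
Let ipDr x y z : ip z (x + y) = ip z x + ip z y.
Proof. exact: linearDr. Qed.
Let ipZl a x z : ip (a *: x) z = a * ip x z.
Proof. exact: linearZl_LR. Qed.
Let ipZr a x z : ip z (a *: x) = a * ip z x.
Proof. exact: linearZr_LR. Qed.
Let ipC x y : ip x y = ip y x.
Proof. by have := @hermC R false idfun H ip x y; rewrite expr0 mul1r. Qed.
Let ipN x z : ip (- x) z = - ip x z.
Proof. by rewrite -scaleN1r ipZl mulN1r. Qed.
Let ipB x y z : ip (x - y) z = ip x z - ip y z.
Proof. by rewrite ipDl ipN. Qed.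

(* A crude form of the Cauchy-Schwarz inequality, by polarization. *)
Lemma inner_product_bound x y : `|ip x y| <= 4 * `|x| * `|y|.
Proof.
have unit_case u v : `|u| <= 1 -> `|v| <= 1 -> `|ip u v| <= 4.
  move=> u1 v1; have uv : `|u + v| <= 2.
    by rewrite (le_trans (ler_normD _ _))// -[2]/(1 + 1) lerD.
  have : ip (u + v) (u + v) = ip u u + 2 * ip u v + ip v v.
    by rewrite ipDl !ipDr (ipC v u); ring.
  rewrite !ip_norm => h.
  have : ip u v = 2^-1 * (`|u + v| ^+ 2 - `|u| ^+ 2 - `|v| ^+ 2) by rewrite h; field.
  have b2 : `|u + v| ^+ 2 <= 4 by rewrite -[4]/(2 * 2)%:R natrM expr2 ler_pM.
  have bu : `|u| ^+ 2 <= 1 by rewrite expr_le1.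
  have bv : `|v| ^+ 2 <= 1 by rewrite expr_le1.
  have := sqr_ge0 `|u + v|; have := sqr_ge0 `|u|; have := sqr_ge0 `|v|.
  move=> ? ? ? ->; rewrite ler_norml; apply/andP; split; lra.
have [->|x0] := eqVneq x 0.
  have -> : ip 0 y = 0 by rewrite -(scale0r (0 : H)) ipZl mul0r.
  by rewrite !normr0 mulr0 mul0r.
have [->|y0] := eqVneq y 0.
  have -> : ip x 0 = 0 by rewrite -(scale0r (0 : H)) ipZr mul0r.
  by rewrite !normr0 mulr0.
have := @unit_case (`|x|^-1 *: x) (`|y|^-1 *: y).
rewrite !normrZ !normfV !normr_id !mulVf ?normr_eq0// => /(_ (lexx _) (lexx _)).
rewrite ipZl ipZr !normrM !normfV !normr_id.
by rewrite mulrCA ler_pdivrMl ?normr_gt0// ler_pdivrMl ?normr_gt0// => /le_trans; apply; lra.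
Qed.

Lemma embedding_bound : exists2 C : R, 0 < C & forall v, `|j v| <= C * `|v|.
Proof.
have cj : continuous (j : {linear U -> H}) by exact: emb_continuous.
have /linear_bounded_continuous/linear_boundedP[r [_ fr]] := cj.
exists (`|r| + 1); first by rewrite ltr_wpDl.
by apply: fr; rewrite (le_lt_trans (ler_norm r))// ltrDl.
Qed.

Lemma H_to_dual_bound : exists2 C : R, 0 < C &
  forall h k, `|H_to_dual ip j h - H_to_dual ip j k| <= C * `|h - k|.
Proof.
have [C C0 jC] := embedding_bound.
exists (4 * C); first by rewrite mulr_gt0.
move=> h k; apply: dual_norm_le => v v1.
rewrite dualB [X in `|X|](_ : _ = ip h (j v) - ip k (j v))// -ipB.
rewrite (le_trans (inner_product_bound _ _))//.
rewrite (le_trans (ler_wpM2l _ (jC v))) ?mulr_ge0//.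
rewrite [leLHS](_ : _ = 4 * C * `|h - k| * `|v|); last by ring.
by rewrite ler_piMr// !mulr_ge0// ltW.
Qed.

Lemma H_to_dual_inj : injective (H_to_dual ip j).
Proof.
move=> h k hk; apply/eqP; rewrite -subr_eq0 -normr_le0; apply/ler_addgt0Pl => e e0.
rewrite addr0; have [C C0 jC] := embedding_bound.
have orth v : ip (h - k) (j v) = 0.
  have := congr1 (fun f : dual U => f v) hk.
  by rewrite /= => hkv; rewrite ipB hkv subrr.
have [h0|h0] := eqVneq (h - k) 0; first by rewrite h0 normr0 ltW.
have n0 : 0 < `|h - k| by rewrite normr_gt0.
(* The radius [e / 4] absorbs the constant 4 of [inner_product_bound], since [h - k] is orthogonal
   to every [j v]. *)
have [||y0 [hv [v _ vE]]] := @emb_dense _ _ _ j (ball (h - k) (e / 4)).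
- by exists (h - k); apply: ballxx; rewrite divr_gt0.
- by apply: ball_open; rewrite divr_gt0.
move: hv; rewrite -vE -ball_normE/= => hv.
have : `|h - k| ^+ 2 <= 4 * `|h - k| * `|h - k - j v|.
  rewrite -(ip_norm ip) -[X in ip _ X](subrK (j v)) ipDr orth addr0.
  by rewrite (le_trans (ler_norm _))// inner_product_bound.
by rewrite expr2 -mulrA mulrCA ler_pM2l// => /le_trans; apply; lra.
Qed.

Lemma gelfand_inj (u v : U) :
  H_to_dual ip j (j u) = H_to_dual ip j (j v) -> u = v.
Proof. by move/H_to_dual_inj/emb_inj. Qed.

Lemma dual_separable : separable_space U -> dense (range (H_to_dual ip j)) ->
  separable_space (dual U).
Proof.
move=> /separable_seq[c cP] dH.
have [C1 C10 jC] := embedding_bound; have [C2 C20 HC] := H_to_dual_bound.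
exists (range (fun n => H_to_dual ip j (j (c n)))); split; first exact: card_image_le.
move=> V [f Vf] oV.
have : nbhs f V by exact: open_nbhs_nbhs.
rewrite -nbhs_ballE => -[e /= e0 eV].
have e2 : 0 < e / 2 by rewrite divr_gt0.
have e4 : 0 < e / 2 / 2 by rewrite divr_gt0.
have [||y1 [fh [h _ hE]]] := dH (ball f (e / 2)).
- by exists f; exact: ballxx.
- exact: ball_open.
(* The error budget is [e / 2] from [f] to [h], then [e / 4] from [h] to [j v] and again from [v] to
   [c n], divided by the Lipschitz constants [C2] and [C1]. *)
have [||y0 [hv [v _ vE]]] := @emb_dense _ _ _ j (ball h (e / 2 / 2 / C2)).
- by exists h; apply: ballxx; rewrite divr_gt0.
- by apply: ball_open; rewrite divr_gt0.
have [n cn] := cP v (e / 2 / 2 / C2 / C1) (divr_gt0 (divr_gt0 e4 C20) C10).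
move: hv fh; rewrite -hE -vE -!ball_normE/= ltr_pdivlMr// mulrC => hv fh.
exists (H_to_dual ip j (j (c n))); split; last by exists n.
apply: eV; rewrite -ball_normE/=.
have jvc : C2 * `|j v - j (c n)| < e / 2 / 2.
  rewrite mulrC -ltr_pdivlMr// -linearB (le_lt_trans (jC _))//.
  by rewrite mulrC -ltr_pdivlMr.
rewrite -[X in `|X|](subrKA (H_to_dual ip j h)) (le_lt_trans (ler_normD _ _))//.
have hc : C2 * `|h - j (c n)| < e / 2.
  rewrite [e / 2]splitr (le_lt_trans _ (ltrD hv jvc))// -mulrDr ler_wpM2l ?(ltW C20)//.
  by rewrite -[h - j (c n)](subrKA (j v)) ler_normD.
by rewrite [e]splitr ltrD// (le_lt_trans (HC h (j (c n))) hc).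
Qed.

End gelfand_facts.

(** * Integrals over [[0, T]] and the space [X1] *)

Lemma aeS {d} {S : measurableType d} {R : realType} {mu : {measure set S -> \bar R}}
    (A B : S -> Prop) : (forall x, A x -> B x) ->
  (\forall x \ae mu, A x) -> \forall x \ae mu, B x.
Proof.
move=> AB [N [mN N0 AN]]; exists N; split => // x nB; apply: AN.
by move=> Ax; exact: nB (AB _ Ax).
Qed.

Lemma aeS2 {d} {S : measurableType d} {R : realType} {mu : {measure set S -> \bar R}}
    (A B C : S -> Prop) : (forall x, A x -> B x -> C x) ->
  (\forall x \ae mu, A x) -> (\forall x \ae mu, B x) -> \forall x \ae mu, C x.
Proof.
move=> ABC nA nB; have [] := (negligibleU nA nB).
move=> N [mN N0 AN]; exists N; split => // x nC; apply: AN.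
by apply: contra_notP nC; rewrite not_orE => -[/contrapT ? /contrapT ?]; exact: ABC.
Qed.

Section leb_itv.
Context {R : realType} (T : R).
Local Notation mu := (@lebesgue_measure R).

Lemma leb_itvE (A : set R) : leb_itv T A = mu (A `&` `[0, T]).
Proof. by []. Qed.

Lemma leb_itv_aeP (Q : R -> Prop) :
  (\forall t \ae leb_itv T, Q t) <-> (\forall t \ae mu, t \in `[0, T] -> Q t).
Proof.
split=> [[N [mN N0 QN]]|[N [mN N0 QN]]].
  exists (N `&` `[0, T]); split => //; first exact: measurableI.
  by move=> t /= /not_implyP[tT Qt]; split => //; exact: QN.
exists (N `|` ~` `[0, T]); split.
- by apply: measurableU => //; exact: measurableC.
- rewrite leb_itvE setIUl setICl setU0.
  by apply: (subset_measure0 _ _ (@subIsetl _ _ _)) => //; exact: measurableI.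
- move=> t /= Qt; have [tT|tT] := boolP (t \in `[0, T]); last by right; apply/negP.
  by left; apply: QN => /= /(_ tT).
Qed.

Lemma leb_itv_integral (f : R -> \bar R) : measurable_fun setT f ->
  (forall x, 0 <= f x)%E ->
  (\int[leb_itv T]_x f x = \int[mu]_(x in `[0%R, T]) f x)%E.
Proof.
move=> mf f0.
have mC : measurable (~` `[0%R, T]%classic : set (measurableTypeR R)) by exact: measurableC.
have N0 : leb_itv T (~` `[0%R, T]%classic) = 0%E by rewrite leb_itvE setICl measure0.
rewrite (ge0_negligible_integral mC measurableT mf (fun x _ => f0 x) N0).
rewrite setTD setCK; apply: eq_measure_integral => A mA AT.
by rewrite leb_itvE setIidl.
Qed.

Lemma leb_itv_finite : (leb_itv T setT < +oo)%E.
Proof.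
rewrite leb_itvE setTI lebesgue_measure_itv/= lte_fin.
by case: ifP => _; rewrite -?EFinD ltry.
Qed.

End leb_itv.

(** A form of [in_L1] free of the quantifier over classes, suited to proving it a Borel condition on
    the path. *)
Definition fin_L1 {R : realType} {E : normedModType R} (T : R) (f : R -> E) :=
  (\int[lebesgue_measure]_(s in `[0%R, T]) (`|f s|)%:E < +oo)%E.

Section L1.
Context {R : realType} (T : R).
Local Notation mu := (@lebesgue_measure R).

Lemma in_L1P {U : completeNormedModType R} (f : measurableTypeR R -> dual U) :
  separable_space (dual U) ->
  measurable_fun setT (f : measurableTypeR R -> borel (dual U)) ->
  in_L1 T f <-> fin_L1 T f.
Proof.
move=> sU mf; have mnf := borel_measurable_norm mf.
have normE : (\int[leb_itv T]_s (`|f s|)%:E = \int[mu]_(s in `[0%R, T]) (`|f s|)%:E)%E.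
  apply: leb_itv_integral => //; exact/measurable_EFinP.
have L1E (g : measurableTypeR R -> dual U) :
    Lnorm_vec (leb_itv T) 1 g = (\int[leb_itv T]_s (`|g s|)%:E)%E.
  rewrite Lnorm_vecE invr1 poweRe1; last first.
    by apply: integral_ge0 => x _; rewrite lee_fin powR_ge0.
  by apply: eq_integral => x _; rewrite powRr1.
split=> [[w fw]|fT].
  rewrite /fin_L1 -normE.
  rewrite (@ae_eq_integral _ _ _ (leb_itv T) setT (fun s => (`|Lp_repr w s|)%:E)) //.
  - by rewrite -L1E; exact: bochner_fin.
  - exact/measurable_EFinP.
  - exact/measurable_EFinP/strongly_measurable_norm/bochner_strong.
  - by apply: aeS fw => s /= -> _.
have fP : (f : measurableTypeR R -> dual U) \in bochner_pred (leb_itv T) 1.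
  apply/mem_set; split; first exact: borel_strongly_measurable.
  by rewrite L1E normE.
exists (Lp_class (BochnerFun (lexx 1) fP)).
have := Lp_classK (BochnerFun (lexx 1) fP).
by apply: filterS => s /(_ I) ->.
Qed.

Lemma fin_L1_integrable {U : completeNormedModType R} (f : measurableTypeR R -> dual U)
    (v : U) t :
  measurable_fun setT (f : measurableTypeR R -> borel (dual U)) ->
  fin_L1 T f -> t <= T -> mu.-integrable `[0, t] (EFin \o (fun s => f s v)).
Proof.
move=> mf fT tT.
have mfv : measurable_fun setT (fun s => f s v).
  apply: (@measurableT_comp _ _ _ _ _ _ (fun g : borel (dual U) => (g : dual U) v)) => //.
  exact: (continuous_measurable_borel (@dual_ev_continuous R U v)).
have mnf := borel_measurable_norm mf.
have sub : (`[0, t]%classic : set R) `<=` `[0, T].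
  by move=> s /=; rewrite !in_itv/= => /andP[-> /le_trans]; apply.
have mT : measurable (`[0, T]%classic : set (measurableTypeR R)) by [].
have mt : measurable (`[0, t]%classic : set (measurableTypeR R)) by [].
have intn : mu.-integrable `[0, T] (fun s => (`|v|%:E * (`|f s|)%:E)%E).
  apply: integrableZl => //; apply/integrableP; split.
    by apply/measurable_EFinP; exact: measurable_funTS.
  by under eq_integral do rewrite /= normr_id.
apply: (integrableS mT mt sub); apply: (@le_integrable _ _ _ _ _ mT _ _ _ _ intn).
  by apply/measurable_EFinP; exact: measurable_funTS.
move=> s _ /=; rewrite lee_fin (le_trans (dual_bound _ _))// mulrC.
by rewrite ger0_norm// mulr_ge0.
Qed.

End L1.

Lemma cpath_ext {R : realType} {T : R} {X : normedModType R} (c1 c2 : cpath T X) :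
  (forall t, t \in `[0, T] -> c1 t = c2 t) -> c1 = c2.
Proof.
move=> h; apply: val_inj; apply/funext => t /=.
have [tT|tT] := boolP (t \in `[0, T]); first exact: h.
have /set_mem[_ ->//] := cpathP c1; by have /set_mem[_ ->//] := cpathP c2.
Qed.

Lemma cpath_ev_continuous {R : realType} {T : R} {X : normedModType R} t :
  t \in `[0, T] -> continuous (fun c : cpath T X => c t).
Proof.
move=> tT c.
apply/(@cvgrPdist_lt R X (cpath T X) (nbhs c) _ (fun c : cpath T X => c t) (c t)) => e e0.
have : nbhs (@cpath_fun R T X c : {uniform` `[0, T] -> X})
    [set h : {uniform` `[0, T] -> X} | `|(c t : X) - h t| < e].
  apply/uniform_nbhs; exists [set xy | `|xy.1 - xy.2| < e]; split.
    by rewrite -entourage_ballE; exists e => //= -[x y]; rewrite /= -ball_normE.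
  by move=> h; exact.
exact: (@initial_continuous _ _ (@cpath_fun R T X : cpath T X -> {uniform` `[0, T] -> X}) c).
Qed.

Section X1_facts.
Context {R : realType} {U H : completeNormedModType R}.
Variables (ip : inner_product H) (j : dense_embedding U H).
Variables (T r : R) (r1 : 1 < r).
Local Notation X1 := (X1 ip j T r1).
Local Notation XC := (@X1_C R U H ip j T r r1).
Local Notation XL := (@X1_L R U H ip j T r r1).
Local Notation LpU := (Lp U (leb_itv T) (ltW r1)).
Implicit Types u : X1.

Lemma X1_C_continuous : continuous XC.
Proof.
move=> u; have /cvg_sup/(_ true) h : nbhs u --> u by [].
by apply: cvg_trans (@initial_continuous _ _ XC u); exact: cvg_app.
Qed.

Lemma X1_L_continuous : continuous XL.
Proof.
move=> u; have /cvg_sup/(_ false) h : nbhs u --> u by [].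
by apply: cvg_trans (@initial_continuous _ _ XL u); exact: cvg_app.
Qed.

Lemma X1_weak_continuous (f : dual LpU) :
  continuous (fun u : X1 => f (X1_L u : LpU)).
Proof.
move=> u; apply: (@continuous_comp X1 (weak LpU) R XL
  (fun x => f (x : LpU))).
  exact: X1_L_continuous.
move: (X1_L u) => x; have /cvg_sup/(_ f) h : nbhs x --> x by [].
apply: cvg_trans (@initial_continuous _ _ (f : weak LpU -> R) x).
exact: cvg_app.
Qed.

Lemma X1_ev_continuous t (v : U) : t \in `[0, T] ->
  continuous (fun u : X1 => X1_C u t v).
Proof.
move=> tT u; apply: (@continuous_comp X1 (dual U) R (fun u : X1 => X1_C u t)
  (fun f : dual U => f v)); last exact: dual_ev_continuous.
apply: (@continuous_comp X1 (cpath T (dual U)) (dual U) XC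
  (fun c : cpath T (dual U) => c t)); first exact: X1_C_continuous.
exact: cpath_ev_continuous.
Qed.

Lemma X1_CE u : \forall t \ae leb_itv T, X1_C u t = H_to_dual ip j (j (X1_path u t)).
Proof. by case: u => u uP; have /set_mem := uP. Qed.

Lemma X1_C_inj : injective XC.
Proof.
move=> u1 u2 u12; apply: val_inj; case: u1 u2 u12 => [[c1 l1] P1] [[c2 l2] P2] /= c12.
rewrite /X1_C/= in c12; rewrite c12; congr pair.
rewrite -[l1]Lp_reprK -[l2]Lp_reprK; apply/Lp_class_eqP.
apply: aeS2 (X1_CE (MkX1 P1)) (X1_CE (MkX1 P2)) => t h1 h2 _.
apply: (@gelfand_inj _ _ _ ip j).
by rewrite -[LHS]h1 -[RHS]h2 /X1_C/= c12.
Qed.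

Lemma X1_path_measurable u :
  measurable_fun setT (X1_path u : measurableTypeR R -> borel U).
Proof. exact/strongly_measurable_borel/bochner_strong. Qed.

End X1_facts.

(** * A jointly measurable choice of representatives *)

Lemma countable_glue_measurable {d1 d2 d3} {S1 : measurableType d1}
    {S2 : measurableType d2} {S3 : measurableType d3} {I : countType}
    (kappa : S1 -> I) (h : I -> S2 -> S3) :
  (forall i, measurable (kappa @^-1` [set i])) ->
  (forall i, measurable_fun setT (h i)) ->
  measurable_fun setT (fun z : S1 * S2 => h (kappa z.1) z.2).
Proof.
move=> mk mh _ B mB; rewrite setTI.
have -> : (fun z : S1 * S2 => h (kappa z.1) z.2) @^-1` B =
    \bigcup_i (kappa @^-1` [set i] `*` h i @^-1` B).
  apply/seteqP; split=> [[a b] /= Bh|[a b] [i _ [/= -> ]]//].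
  by exists (kappa a).
apply: countable_bigcupT_measurable => // i; apply: measurableX; first exact: mk.
by rewrite -[X in measurable X]setTI; exact: mh.
Qed.

(** Completeness recovers a point from its distances to a dense sequence: the value of [c] at the
    first index closer than [n.+1%:R^-1] converges to it. Using [rho] alone yields a [g] measurable
    on all of [S]. *)
Lemma measurable_from_distances {R : realType} {U : completeNormedModType R}
    {d} {S : measurableType d} (c : nat -> U) (rho : nat -> S -> \bar R) :
  (forall x e, 0 < e -> exists k, `|x - c k| < e) ->
  (forall k, measurable_fun setT (rho k)) ->
  exists g : S -> U, measurable_fun setT (g : S -> borel U) /\
    forall z y, (forall k, rho k z = (`|y - c k|)%:E) -> g z = y.
Proof.
move=> cP mrho.
pose near_ n z k := (rho k z < (n.+1%:R^-1)%:E)%E.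
(* The first condition supplies an index at every precision; the second, a triangle inequality,
   makes the selected points a Cauchy sequence. Genuine distances satisfy both. *)
pose G := (\bigcap_n \bigcup_k [set z | near_ n z k]) `&`
  \bigcap_k \bigcap_l [set z | ((`|c k - c l|)%:E <= rho k z + rho l z)%E].
have mnear n k : measurable [set z | near_ n z k].
  by rewrite -[X in measurable X]setTI; apply: measurable_lte.
have mG : measurable G.
  apply: measurableI.
    by apply: bigcapT_measurable => n; apply: bigcupT_measurable => k; exact: mnear.
  apply: bigcapT_measurable => k; apply: bigcapT_measurable => l.
  rewrite -[X in measurable X]setTI; apply: measurable_lee => //.
  exact: emeasurable_funD.
pose m n z := xget 0%N [set k | near_ n z k /\ forall i, (i < k)%N -> ~~ near_ n z i].
have mP n z : G z -> near_ n z (m n z).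
  move=> [/(_ n I)[k _ nk] _]; rewrite /m; case: xgetP => [? ? []//|].
  have exn : exists k, near_ n z k by exists k.
  have := ex_minnP exn; case=> k0 nk0 k0min /(_ k0)[]; split => // i ik0.
  by apply/negP => /k0min; rewrite leqNgt ik0.
have mm n k : measurable (G `&` [set z | m n z = k]).
  have -> : G `&` [set z | m n z = k] = G `&` ([set z | near_ n z k] `&`
      \bigcap_(i in `I_k) ~` [set z | near_ n z i]).
    apply/seteqP; split=> z [Gz]; rewrite /m/=.
      case: xgetP => [? -> [nk lk] <-|].
        by split => //; split => // i /= /lk/negP.
      move=> no _; exfalso; have := mP n z Gz; rewrite /m; case: xgetP => [? _|_].
        by move=> /no.
      have [/(_ n I)[k1 _ nk1] _] := Gz; have exn : exists k, near_ n z k by exists k1.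
      have := ex_minnP exn; case=> k0 nk0 k0min _; case: (no k0); split => // i ik0.
      by apply/negP => /k0min; rewrite leqNgt ik0.
    move=> [nk lk]; split => //; case: xgetP => [k1 _ [nk1 lk1]|/(_ k)[]].
      have [k1k|kk1|//] := ltngtP k1 k; first by case: (lk k1 k1k).
      by have := lk1 _ kk1; rewrite nk.
    by split => // i ik; apply/negP; exact: lk.
  apply: measurableI => //; apply: measurableI; first exact: mnear.
  by apply: bigcap_measurableType => i _; apply: measurableC; exact: mnear.
pose h n z := if `[< G z >] then c (m n z) else 0.
have mh n : measurable_fun setT (h n : S -> borel U).
  apply: measurable_fun_borel => B cB.
  have -> : h n @^-1` B = (\bigcup_(k in [set k | B (c k)]) (G `&` [set z | m n z = k]))
      `|` (~` G `&` (cst 0 @^-1` B)).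
    apply/seteqP; split=> z /=; rewrite /h.
      by case: asboolP => Gz Bz; [left; exists (m n z)|right].
    case=> [[k /= Bk [Gz mk]]|[nGz Bz]]; first by case: asboolP => // _; rewrite mk.
    by case: asboolP.
  apply: measurableU; first by apply: bigcup_measurable => k _; exact: mm.
  apply: measurableI; first exact: measurableC.
  by rewrite preimage_cst; case: ifP.
have h_cvg z : cvgn (fun n => h n z).
  rewrite /h; case: asboolP => Gz; last exact: is_cvg_cst.
  apply/cauchy_cvgP/cauchy_ballP => e e0; have e20 : 0 < e / 2 by rewrite divr_gt0.
  have [N _ NP] := near_infty_natSinv_lt (PosNum e20).
  pose tail := (fun n => c (m n z)) @` [set k | (N <= k)%N].
  exists (tail, tail); first by split; exists N => // k Nk; exists k.
  move=> [_ _] /= [[k Nk <-] [l Nl <-]]; rewrite -ball_normE/= -lte_fin.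
  apply: le_lt_trans (Gz.2 (m k z) I (m l z) I) _; rewrite [e]splitr EFinD.
  apply: lteD; first by apply: lt_trans (mP k z Gz) _; rewrite lte_fin; exact: NP.
  by apply: lt_trans (mP l z Gz) _; rewrite lte_fin; exact: NP.
exists (fun z => limn (fun n => h n z)); split.
  by apply: borel_measurable_lim mh _ => z; exact: h_cvg.
move=> z y rE.
have Gz : G z.
  split=> [n _|k _ l _] /=.
    have [|k yk] := cP y n.+1%:R^-1; first by rewrite invr_gt0.
    by exists k => //; rewrite /near_/= rE lte_fin.
  by rewrite !rE -EFinD lee_fin [`|y - c k|]distrC -[c k - c l](subrKA y) ler_normD.
apply/cvg_lim => //; apply/cvgrPdist_lt => e e0.
have [N _ NP] := near_infty_natSinv_lt (PosNum e0).
exists N => // n /= Nn; rewrite /h asboolT//.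
by have := mP n z Gz; rewrite /near_ rE lte_fin => /lt_trans; apply; exact: NP.
Qed.

(** * Local L^1 seminorms on L^r and their norming functionals *)

Section local_norm.
Context {R : realType} {X : completeNormedModType R}.
Context (T r : R) (r1 : 1 <= r) (I : set R).
Hypothesis mI : measurable (I : set (measurableTypeR R)).
Local Notation nu := (leb_itv T).
Local Notation LpX := (Lp X nu r1).
Implicit Types x y : LpX.

Definition local_norm x := fine (\int[nu]_(s in I) (`|Lp_repr x s|)%:E).

Let mnorm (f : bochner_fun X nu r1) :
  measurable_fun setT (fun s => (`|f s|)%:E).
Proof. exact/measurable_EFinP/strongly_measurable_norm/bochner_strong. Qed.

Let mpow (f : bochner_fun X nu r1) :
  measurable_fun setT (fun s => (`|f s| `^ r)%:E).
Proof.
apply/measurable_EFinP/(@measurableT_comp _ _ _ _ _ _ (@powR R ^~ r)) => //.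
exact/strongly_measurable_norm/bochner_strong.
Qed.

Lemma Lp_repr_ae (f : bochner_fun X nu r1) x : Lp_class f = x ->
  \forall s \ae nu, Lp_repr x s = f s.
Proof. by move=> <-; apply: aeS (Lp_classK f) => s /(_ Logic.I). Qed.

Lemma Lp_reprD_ae x y :
  \forall s \ae nu, Lp_repr (x + y) s = Lp_repr x s + Lp_repr y s.
Proof.
apply: (@Lp_repr_ae (Lp_repr x + Lp_repr y)).
by rewrite Lp_classD !Lp_reprK.
Qed.

Lemma Lp_reprZ_ae a x : \forall s \ae nu, Lp_repr (a *: x) s = a *: Lp_repr x s.
Proof.
apply: (@Lp_repr_ae (a *: Lp_repr x)).
by rewrite Lp_classZ Lp_reprK.
Qed.

(** From [a <= 1 + a ^ r]. On a finite measure this replaces Hoelder's inequality, as only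
    finiteness and a bound on the unit ball are wanted. *)
Lemma local_norm_le_power x : (\int[nu]_(s in I) (`|Lp_repr x s|)%:E <=
  nu setT + \int[nu]_s (`|Lp_repr x s| `^ r)%:E)%E.
Proof.
have -> : (nu setT + \int[nu]_s (`|Lp_repr x s| `^ r)%:E =
    \int[nu]_s (1%:E + (`|Lp_repr x s| `^ r)%:E))%E.
  by rewrite ge0_integralD// integral_cst// mul1e.
apply: (@le_trans _ _ (\int[nu]_s (`|Lp_repr x s|)%:E)%E).
  exact: ge0_subset_integral.
apply: ge0_le_integral => //.
  exact: emeasurable_funD.
move=> s _; rewrite -EFinD lee_fin.
have [s1|s1] := leP `|Lp_repr x s| 1.
  by rewrite (le_trans s1)// lerDl powR_ge0.
by rewrite -[leLHS]powRr1// ler_wpDl// ler_powR// ltW.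
Qed.

Lemma power_integral_le1 x : `|x| <= 1 ->
  (\int[nu]_s (`|Lp_repr x s| `^ r)%:E <= 1)%E.
Proof.
rewrite -[`|x|]/(Lp_norm x) /Lp_norm => x1.
have r0 : 0 < r by rewrite (lt_le_trans _ r1).
have := bochner_fin (Lp_repr x); rewrite Lnorm_vecE => /lty_poweRy.
rewrite invr_eq0 gt_eqF// => /(_ isT) Jfin.
have J0 : (0 <= \int[nu]_s (`|Lp_repr x s| `^ r)%:E)%E.
  by apply: integral_ge0 => s _; rewrite lee_fin powR_ge0.
move: x1; rewrite Lnorm_vecE; move: (\int[nu]_s _)%E J0 Jfin => [a| |]//.
rewrite lee_fin => a0 _; rewrite poweR_EFin/= lee_fin => a1.
have -> : a = (a `^ r^-1) `^ r by rewrite -powRrM mulVf ?lt0r_neq0// powRr1.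
have <- : 1 `^ r = 1 :> R by rewrite powR1.
by apply: ge0_ler_powR; rewrite ?nnegrE ?powR_ge0// ltW.
Qed.

Lemma local_norm_fin x : (\int[nu]_(s in I) (`|Lp_repr x s|)%:E < +oo)%E.
Proof.
apply: le_lt_trans (local_norm_le_power x) _.
rewrite lte_add_pinfty//; first exact: leb_itv_finite.
have := bochner_fin (Lp_repr x); rewrite Lnorm_vecE; apply: lty_poweRy.
by rewrite invr_eq0 gt_eqF// (lt_le_trans _ r1).
Qed.

Lemma local_normE x : (local_norm x)%:E = (\int[nu]_(s in I) (`|Lp_repr x s|)%:E)%E.
Proof. by rewrite /local_norm fineK// ge0_fin_numE ?local_norm_fin// integral_ge0. Qed.

Lemma local_norm_bound x : `|x| <= 1 -> local_norm x <= fine (nu setT) + 1.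
Proof.
move=> x1; rewrite -lee_fin local_normE EFinD fineK; last first.
  by rewrite ge0_fin_numE// leb_itv_finite.
by rewrite (le_trans (local_norm_le_power x))// leeD2l// power_integral_le1.
Qed.

Lemma local_norm_sublinear : sublinear local_norm.
Proof.
split=> [x y|a x a0].
  rewrite -lee_fin EFinD !local_normE.
  rewrite (@ae_eq_integral _ _ _ nu I (fun s => (`|Lp_repr x s + Lp_repr y s|)%:E)) //.
  - rewrite -ge0_integralD//; [|exact: measurable_funTS|exact: measurable_funTS].
    apply: ge0_le_integral => //.
    + exact: (measurable_funTS (mnorm (Lp_repr x + Lp_repr y))).
    + by apply: emeasurable_funD; exact: measurable_funTS.
    + by move=> s _; rewrite -EFinD lee_fin ler_normD.
  - exact: measurable_funTS.
  - exact: (measurable_funTS (mnorm (Lp_repr x + Lp_repr y))).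
  - by apply: aeS (Lp_reprD_ae x y) => s -> _.
rewrite -lee_fin EFinM !local_normE.
rewrite (@ae_eq_integral _ _ _ nu I (fun s => (a%:E * (`|Lp_repr x s|)%:E)%E)) //.
- by rewrite ge0_integralZl_EFin ?(ltW a0)//; exact: measurable_funTS.
- exact: measurable_funTS.
- by apply: emeasurable_funM => //; exact: measurable_funTS.
- by apply: aeS (Lp_reprZ_ae a x) => s -> _; rewrite normrZ gtr0_norm.
Qed.

(* Norming functionals make [local_norm] weakly lower semicontinuous. *)
Lemma local_norm_norming x0 : exists f : dual LpX,
  (forall x, f x <= local_norm x) /\ f x0 = local_norm x0.
Proof.
have [f [lf fle fx0]] := hahn_banach x0 local_norm_sublinear.
have f0 : f 0 = 0 by rewrite -[X in f X](subrr 0) -scaleN1r addrC lf scaleN1r addNr.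
have fZ a x : f (a *: x) = a * f x by rewrite -[a *: x]addr0 lf f0 addr0.
pose fl : {linear LpX -> R^o} := HB.pack f (GRing.isLinear.Build R LpX R^o *:%R f lf).
pose C := fine (nu setT) + 1.
have C0 : 0 <= C by rewrite addr_ge0// fine_ge0.
have fC x : `|f x| <= C * `|x|.
  have [->|xn0] := eqVneq x 0; first by rewrite f0 !normr0 mulr0.
  have x0' : 0 < `|x| by rewrite normr_gt0.
  rewrite -ler_pdivrMr//.
  (* Used with [a] equal to the inverse of the norm of [x] or to its opposite, according to the sign
     of [f x]. *)
  have unit_le a : `|a| = `|x|^-1 -> a * f x <= C.
    move=> ax; rewrite -fZ (le_trans (fle _))// local_norm_bound//.
    by rewrite normrZ ax mulVf// gt_eqF.
  have [fx|fx] := leP 0 (f x).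
    by rewrite ger0_norm// mulrC unit_le// ger0_norm// invr_ge0.
  by rewrite ltr0_norm// mulNr -mulrN mulrC unit_le// normrN ger0_norm// invr_ge0.
have cf : continuous fl.
  apply/linear_bounded_continuous/linear_boundedP; near=> M => x.
  rewrite (le_trans (fC x))// ler_wpM2r//.
have fP : (f : LpX -> R^o) \in @dual_pred R LpX by apply/mem_set.
by exists (Dual fP).
Unshelve. all: by end_near. Qed.

End local_norm.

Section joint_version.
Context {R : realType} {U H : completeNormedModType R}.
Variables (ip : inner_product H) (j : dense_embedding U H).
Variables (T r : R) (r1 : 1 < r).
Local Notation X1 := (X1 ip j T r1).
Local Notation nu := (leb_itv T).
Local Notation mu := (@lebesgue_measure R).
Local Notation LpU := (Lp U nu (ltW r1)).

Fact cst_bochner (c : U) : cst c \in @bochner_pred _ (measurableTypeR R) R U nu r.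
Proof.
apply/mem_set; split.
  by exists (fun=> cst c); split=> [_|s]; [exact: simple_fun_cst|exact: cvg_cst].
rewrite Lnorm_vecE; apply: poweR_lty.
rewrite [X in (X < _)%E](_ : _ = ((`|c| `^ r)%:E * nu setT)%E); last first.
  exact: (@integral_cst _ _ _ nu setT measurableT (`|c| `^ r)%:E).
by rewrite lte_mul_pinfty// ?lee_fin ?powR_ge0// leb_itv_finite.
Qed.

Let cst_class (c : U) : LpU := Lp_class (BochnerFun (ltW r1) (cst_bochner c)).

Lemma X1_dist_measurable (u : X1) (c : U) :
  measurable_fun setT (fun s : measurableTypeR R => (`|X1_path u s - c|)%:E).
Proof.
apply/measurable_EFinP; apply: (borel_measurable_normB c); exact: X1_path_measurable.
Qed.

Lemma X1_dist_integralE (I : set (measurableTypeR R)) (u : X1) (c : U) :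
  measurable I -> (\int[nu]_(s in I) (`|X1_path u s - c|)%:E =
    (local_norm I ((X1_L u : LpU) - cst_class c))%:E)%E.
Proof.
move=> mI; rewrite local_normE//.
apply: (@ae_eq_integral _ _ _ nu I) => //.
  by apply: measurable_funTS; exact: X1_dist_measurable.
  apply: measurable_funTS.
  by apply/measurable_EFinP; apply: strongly_measurable_norm; exact: bochner_strong.
apply: aeS2 (Lp_reprD_ae (X1_L u : LpU) (- cst_class c)) (@Lp_repr_ae _ _ _ _ _
  (- BochnerFun (ltW r1) (cst_bochner c)) (- cst_class c) (Lp_classN _)) => s.
by move=> -> -> _.
Qed.

Lemma X1_dist_integral_measurable (I : set (measurableTypeR R)) (c : U) :
  measurable I -> measurable_fun setT (fun u : borel X1 =>
    \int[nu]_(s in I) (`|X1_path u s - c|)%:E)%E.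
Proof.
move=> mI; pose k := cst_class c.
rewrite (funext (fun u : X1 => X1_dist_integralE u c mI)); apply/measurable_EFinP.
apply: (measurability _ (RGenOInfty.measurableE R)) => _ [_ [a ->] <-].
rewrite setTI; pose S : set X1 := (fun u => local_norm I ((X1_L u : LpU) - k)) @^-1` `]a, +oo[.
suff : open S by exact: open_borel.
rewrite openE => u /=.
rewrite /S/= in_itv/= andbT => ua.
(* The functional norming at [u] lies below the seminorm and is continuous on [X1], so the seminorm
   exceeds [a] on a whole neighbourhood of [u]. *)
have [f [fle fu]] := local_norm_norming mI ((X1_L u : LpU) - k).
have := @X1_weak_continuous _ _ _ ip j T r r1 f u.
have fB (x : LpU) : f (x - k) = f x - f k by exact: linearB.
have af : nbhs (f (X1_L u : LpU)) `]a + f k, +oo[%classic.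
  apply: open_nbhs_nbhs; split; first exact: interval_open.
  by rewrite /= in_itv/= andbT -ltrBrDr -fB fu.
move=> /(_ _ af) h; apply: (@filterS X1 (nbhs u) _ _ S _ h) => v.
rewrite /S/= !in_itv/= !andbT -ltrBrDr -fB => av.
exact: lt_le_trans av (fle _).
Qed.

(** A fixed grid instead of balls centred at [t]: for each [n] only countably many sets occur, so
    measurability of the averages in [u] alone gives joint measurability in [(t, u)]. *)
Definition cell n (k : int) : set R := `[k%:~R / n.+1%:R, (k + 1)%:~R / n.+1%:R[%classic.
Definition cell_index n (t : R) : int := Num.floor (t * n.+1%:R).

Lemma cell_indexE n t k : (cell_index n t == k) = (t \in `[k%:~R / n.+1%:R, (k + 1)%:~R / n.+1%:R[).
Proof. by rewrite /cell_index floor_eq in_itv/= ler_pdivrMr// ltr_pdivlMr. Qed.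

Lemma cell_itself n t : cell n (cell_index n t) t.
Proof. by rewrite /cell/= -cell_indexE. Qed.

Lemma cell_length n k : (k + 1)%:~R / n.+1%:R - k%:~R / n.+1%:R = n.+1%:R^-1 :> R.
Proof. by rewrite -mulrBl intrD addrAC subrr add0r mul1r. Qed.

Lemma lebesgue_measure_cell n k : mu (cell n k) = (n.+1%:R^-1)%:E.
Proof.
rewrite lebesgue_measure_itv/= lte_fin ltr_pM2r ?invr_gt0// ltr_int ltzD1 lexx.
by rewrite -EFinB cell_length.
Qed.

Lemma cells_shrink t : nicely_shrinking t (fun n => cell n (cell_index n t)).
Proof.
have inv0 n : 0 < n.+1%:R^-1 :> R by rewrite invr_gt0.
split; first by move=> n; exact: measurable_itv.
(* The cell sits in the ball of radius [n.+1%:R^-1] about [t], whose measure is twice that of the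
   cell. *)
exists (2, fun n => PosNum (inv0 n)); split => //=.
- apply/cvgrPdist_lt => e e0; apply: filterS (near_infty_natSinv_lt (PosNum e0)) => n.
  by rewrite sub0r normrN ger0_norm.
- move=> n s; have := cell_itself n t; rewrite /cell/= -ball_normE/= !in_itv/=.
  move: (cell_index n t) => k /andP[kt tk] /andP[ks sk].
  rewrite -(cell_length n k) ltr_norml opprB.
  by apply/andP; split; [exact: ler_ltB|exact: ltr_leB].
move=> n; rewrite lebesgue_measure_ball// lebesgue_measure_cell -EFinM lee_fin.
by rewrite mulr_natl.
Qed.

End joint_version.

Lemma leb_itv_integral_in {R : realType} (T : R) (I : set (measurableTypeR R))
    (g : measurableTypeR R -> \bar R) : measurable I -> measurable_fun setT g ->
  (forall s, 0 <= g s)%E ->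
  (\int[leb_itv T]_(s in I) g s =
   \int[lebesgue_measure]_(s in I) (if s \in `[0%R, T] then g s else 0))%E.
Proof.
move=> mI mg g0; rewrite integral_mkcond leb_itv_integral; last 2 first.
- by apply/(measurable_restrictT _ _).1 => //; exact: measurable_funTS.
- by move=> s; apply: erestrict_ge0 => ? _.
rewrite integral_mkcond [RHS]integral_mkcond; apply: eq_integral => s _.
rewrite !patchE mem_setE; case: (s \in `[0, T]) => //.
by case: ifP.
Qed.

Section joint_version.
Context {R : realType} {U H : completeNormedModType R}.
Variables (ip : inner_product H) (j : dense_embedding U H).
Variables (T r : R) (r1 : 1 < r).
Local Notation X1 := (X1 ip j T r1).
Local Notation nu := (leb_itv T).
Local Notation mu := (@lebesgue_measure R).

Let average (c : U) n (z : measurableTypeR R * borel X1) : \bar R :=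
  ((n.+1%:R)%:E * \int[nu]_(s in cell n (cell_index n z.1))
     (`|X1_path (z.2 : X1) s - c|)%:E)%E.

Let average_measurable c n : measurable_fun setT (average c n).
Proof.
apply: (@countable_glue_measurable _ _ _ (measurableTypeR R) (borel X1) _ int
  (cell_index n) (fun k (u : borel X1) => (n.+1%:R)%:E * \int[nu]_(s in cell n k)
     (`|X1_path (u : X1) s - c|)%:E)%E) => k.
  rewrite [X in measurable X](_ : _ = cell n k); first exact: measurable_itv.
  apply/seteqP; split=> t /=; rewrite /cell/= -cell_indexE; first by move/eqP.
  by move=> /eqP.
apply: measurable_funeM; apply: X1_dist_integral_measurable; exact: measurable_itv.
Qed.

Let average_cvg (u : X1) (c : U) : \forall t \ae nu,
  average c n (t, u) @[n --> \oo] --> (`|X1_path u t - c|)%:E.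
Proof.
(* Extension by 0 makes the distance locally integrable on the whole line, where Lebesgue
   differentiation takes place. *)
pose f (s : R) : R := if s \in `[0, T] then `|X1_path u s - c| else 0.
have fE s : (f s)%:E = (if s \in `[0%R, T] then (`|X1_path u s - c|)%:E else 0)%E.
  by rewrite /f; case: ifP.
have f0 s : 0 <= f s by rewrite /f; case: ifP.
have mf : measurable_fun setT (f : measurableTypeR R -> R).
  rewrite (_ : f = (fun s => `|X1_path u s - c|) \_ `[0, T]); last first.
    by apply/funext => s; rewrite patchE mem_setE.
  apply/(measurable_restrictT _ _).1 => //; apply: measurable_funTS.
  by have /measurable_EFinP := X1_dist_measurable u c.
have lf : locally_integrable setT f.
  split => //; first exact: openT.
  move=> K _ cK.
  apply: (@le_lt_trans _ _ (\int[mu]_s (f s)%:E)%E).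
    under eq_integral do rewrite ger0_norm//.
    apply: ge0_subset_integral => //.
    - by apply: closed_measurable; apply: compact_closed => //; exact: Rhausdorff.
    - exact/measurable_EFinP.
    - by move=> s _; rewrite lee_fin.
  under eq_integral do rewrite fE.
  rewrite -leb_itv_integral_in//; last exact: X1_dist_measurable.
  by rewrite X1_dist_integralE// ltry.
apply/leb_itv_aeP; apply: aeS (lebesgue_differentiation lf) => t ft tT.
have := nice_lebesgue_differentiation (@cells_shrink R) lf ft.
rewrite fE tT; apply: cvg_trans; apply: near_eq_cvg; apply: nearW => n.
rewrite lebesgue_measure_cell /average inver gt_eqF ?invr_gt0// invrK; congr (_ * _)%E.
rewrite leb_itv_integral_in//; last exact: X1_dist_measurable.
  by apply: eq_integral => s _; rewrite fE.
exact: measurable_itv.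
Qed.

(* Elements of [X1] are classes of functions; evaluating them requires a choice
   of representatives depending measurably on time and on the class. *)
Lemma X1_joint_version : separable_space U ->
  exists g : measurableTypeR R * borel X1 -> U,
    measurable_fun setT (g : _ -> borel U) /\
    forall u : X1, \forall t \ae nu, g (t, u) = X1_path u t.
Proof.
move=> /separable_seq[c cP].
(* The upper limit is measurable everywhere and equals the distance wherever the averages
   converge. *)
have mrho k : measurable_fun setT (fun z => limn_esup (average (c k) ^~ z)).
  exact: measurable_fun_limn_esup.
have [g [mg gP]] := measurable_from_distances cP mrho.
exists g; split => // u.
have : \forall t \ae nu, forall k,
    average (c k) n (t, u) @[n --> \oo] --> (`|X1_path u t - c k|)%:E.
  by apply/ae_foralln => k; exact: average_cvg.
apply: aeS => t ct; apply: gP => k.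
by have [_ ->] := cvg_limn_einf_sup (ct k).
Qed.

End joint_version.

(** The integral is the difference of those of the positive and negative parts, integrable or not,
    so Tonelli's theorem applies to each. *)
Lemma measurable_integral_section {R : realType} {d} {S : measurableType d}
    (I : set (measurableTypeR R)) (phi : measurableTypeR R * S -> \bar R) :
  measurable I -> measurable_fun setT phi ->
  measurable_fun setT (fun u => \int[lebesgue_measure]_(s in I) phi (s, u))%E.
Proof.
move=> mI mphi.
have nneg (f : measurableTypeR R * S -> \bar R) : measurable_fun setT f ->
    (forall z, 0 <= f z)%E ->
    measurable_fun setT (fun u => \int[lebesgue_measure]_(s in I) f (s, u))%E.
  move=> mf f0; have mIX : measurable (fst @^-1` I : set (measurableTypeR R * S)).
    by rewrite -[X in measurable X]setTI; exact: measurable_fst.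
  have mF : measurable_fun setT (f \_ (fst @^-1` I)).
    by apply/(measurable_restrictT _ _).1 => //; exact: measurable_funTS.
  have F0 z : (0 <= (f \_ (fst @^-1` I)) z)%E by apply: erestrict_ge0.
  have := @measurable_fun_fubini_tonelli_G _ _ _ S R lebesgue_measure _ mF F0.
  congr (measurable_fun _ _); apply/funext => u.
  rewrite /fubini_G [RHS]integral_mkcond; apply: eq_integral => s _.
  by rewrite !patchE.
under eq_fun do rewrite integralE.
apply: emeasurable_funB.
- have := nneg (phi ^\+)%E (measurable_funepos mphi) (fun z => funepos_ge0 phi z).
  by congr (measurable_fun _ _); apply/funext => u; apply: eq_integral => s _; rewrite !funeposE.
- have := nneg (phi ^\-)%E (measurable_funeneg mphi) (fun z => funeneg_ge0 phi z).
  by congr (measurable_fun _ _); apply/funext => u; apply: eq_integral => s _; rewrite !funenegE.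
Qed.

(** * Borel dependence of the drift on the path *)

Section drift.
Context {R : realType} {U H : completeNormedModType R}.
Variables (ip : inner_product H) (j : dense_embedding U H).
Variables (T r : R) (r1 : 1 < r) (A : U -> dual U).
Hypothesis sU : separable_space U.
Hypothesis mA : measurable_fun setT (A : borel U -> borel (dual U)).
Local Notation X1 := (X1 ip j T r1).
Local Notation mu := (@lebesgue_measure R).

Lemma drift_measurable (u : X1) : measurable_fun setT
  ((fun s => A (X1_path u s)) : measurableTypeR R -> borel (dual U)).
Proof.
by apply: (@measurableT_comp _ _ _ _ (borel U) (borel (dual U)) A) => //;
  exact: X1_path_measurable.
Qed.

Lemma borel_dual_ev_measurable (v : U) :
  measurable_fun setT (fun f : borel (dual U) => (f : dual U) v).
Proof. exact: (continuous_measurable_borel (@dual_ev_continuous R U v)). Qed.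

Let ae_in (Q : R -> Prop) (I : set R) : I `<=` `[0, T] ->
  (\forall t \ae leb_itv T, Q t) -> \forall t \ae mu, I t -> Q t.
Proof.
move=> IT /leb_itv_aeP; apply: aeS => t Qt It; apply: Qt; exact: IT.
Qed.

(** [X1_path u] rests on an arbitrary representative for each [u]; under the integral the joint
    version [g] takes its place. *)
Lemma measurable_fin_L1_drift :
  measurable [set u : borel X1 | fin_L1 T (A \o X1_path (u : X1))].
Proof.
have [g [mg gE]] := @X1_joint_version _ _ _ ip j T r r1 sU.
have mAg : measurable_fun setT (fun z => (`|A (g z)|)%:E).
  apply/measurable_EFinP; apply: (@borel_measurable_norm _ (dual U) _ _ (A \o g)).
  exact: (@measurableT_comp _ _ _ _ (borel U) (borel (dual U)) A).
have mint := measurable_integral_section (measurable_itv `[0, T]) mAg.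
rewrite [X in measurable X](_ : _ = [set u : borel X1 |
    (\int[mu]_(s in `[0%R, T]) (`|A (g (s, u))|)%:E < +oo)%E]).
  rewrite -[X in measurable X]setTI; apply: measurable_lte => //; exact: measurable_cst.
apply/funext => u; congr (_ < _)%E.
apply: ae_eq_integral => //.
- apply: measurable_funTS; apply/measurable_EFinP.
  exact: (borel_measurable_norm (drift_measurable u)).
- apply: measurable_funTS.
  exact: (measurableT_comp mAg (measurable_pair2 u)).
- by apply: aeS (ae_in (@subset_refl _ _) (gE u)) => s gs sT; rewrite /= gs.
Qed.

Lemma measurable_drift_integral t (v : U) : t <= T ->
  measurable_fun setT (fun u : borel X1 =>
    \int[mu]_(s in `[0, t]) (A (X1_path (u : X1) s) v)).
Proof.
move=> tT; have [g [mg gE]] := @X1_joint_version _ _ _ ip j T r r1 sU.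
have mAg : measurable_fun setT (fun z => (A (g z) v)%:E).
  apply/measurable_EFinP; apply: (measurableT_comp (borel_dual_ev_measurable v)).
  exact: (@measurableT_comp _ _ _ _ (borel U) (borel (dual U)) A).
have mint := measurable_integral_section (measurable_itv `[0, t]) mAg.
rewrite (_ : (fun u => _) = fun u : borel X1 =>
    fine (\int[mu]_(s in `[0%R, t]) (A (g (s, u)) v)%:E)%E).
  exact: (measurableT_comp _ mint).
apply/funext => u; congr fine.
have sub : (`[0, t]%classic : set R) `<=` `[0, T].
  by move=> s /=; rewrite !in_itv/= => /andP[-> /le_trans]; apply.
apply: ae_eq_integral => //.
- apply: measurable_funTS; apply/measurable_EFinP.
  exact: (measurableT_comp (borel_dual_ev_measurable v) (drift_measurable u)).
- apply: measurable_funTS.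
  exact: (measurableT_comp mAg (measurable_pair2 u)).
- by apply: aeS (ae_in sub (gE u)) => s gs st; rewrite /= gs.
Qed.

End drift.

(** * Uniqueness by rescaling time *)

Section dilation.
Context {R : realType}.
Local Notation mu := (@lebesgue_measure R).

Definition dilation (a : R) : measurableTypeR R -> measurableTypeR R := fun s => a * s.

Fact measurable_dilation a : measurable_fun setT (dilation a).
Proof.
apply: (@measurable_funM _ (measurableTypeR R) R setT (cst a) id) => //.
Qed.
HB.instance Definition _ a :=
  isMeasurableFun.Build _ _ _ _ (dilation a) (@measurable_dilation a).

Lemma dilation_preimage_itv a b : 0 < a ->
  dilation a @^-1` `[0, a * b] = `[0, b]%classic.
Proof.
move=> a0; apply/seteqP; split=> s /=; rewrite /dilation !in_itv/=.
  by rewrite ler_pM2l// pmulr_rge0.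
by rewrite ler_pM2l// pmulr_rge0.
Qed.

(** Uniqueness of Lebesgue measure reduces this to half-open intervals. *)
Lemma lebesgue_measure_dilation a (B : set (measurableTypeR R)) (a0 : 0 < a) :
  measurable B -> mu B = (a%:E * mu (dilation a @^-1` B))%E.
Proof.
move=> mB.
apply: (@lebesgue_measure_unique R (mscale (NngNum (ltW a0)) (pushforward mu (dilation a)))) => //.
move=> _ [[x y]] _ <-; rewrite -[RHS]/(a%:E * mu (dilation a @^-1` `]x, y]))%E.
rewrite (_ : dilation a @^-1` `]x, y] = `]a^-1 * x, a^-1 * y]%classic); last first.
  by apply/seteqP; split=> s /=; rewrite /dilation !in_itv/= ltr_pdivrMl// ler_pdivlMl.
rewrite !lebesgue_measure_itv/= !lte_fin ltr_pM2l ?invr_gt0//.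
case: ifP => _; last by rewrite mule0.
by rewrite -!EFinB -EFinM -mulrBr mulrA mulfV ?gt_eqF// mul1r.
Qed.

Lemma ge0_integral_dilation a (D : set (measurableTypeR R)) (f : R -> \bar R) : 0 < a ->
  measurable D -> measurable_fun setT f -> (forall s, 0 <= f s)%E ->
  (\int[mu]_(s in D) f s = a%:E * \int[mu]_(s in dilation a @^-1` D) f (a * s)%R)%E.
Proof.
move=> a0 mD mf f0.
rewrite -(@ge0_integral_pushforward _ _ _ _ _ (dilation a) _ mu D f) //; last first.
  exact: measurable_funTS.
rewrite -(@ge0_integral_mscale _ _ _ _ _ mD (NngNum (ltW a0))) //; last exact: measurable_funTS.
apply: eq_measure_integral => B mB _.
exact: (lebesgue_measure_dilation a0 mB).
Qed.

Lemma integral_dilation a b (f : R -> \bar R) : 0 < a -> measurable_fun setT f ->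
  (\int[mu]_(s in `[0%R, (a * b)%R]) f s = \int[mu]_(s in `[0%R, b]) (a%:E * f (a * s)%R))%E.
Proof.
move=> a0 mf.
have mfa (g : R -> \bar R) : measurable_fun setT g ->
    measurable_fun setT (fun s : measurableTypeR R => g (a * s)).
  by move=> mg; apply: (measurableT_comp mg (measurable_dilation a)).
have nneg (g : R -> \bar R) : measurable_fun setT g -> (forall s, 0 <= g s)%E ->
    (\int[mu]_(s in `[0%R, (a * b)%R]) g s = \int[mu]_(s in `[0%R, b]) (a%:E * g (a * s)%R))%E.
  move=> mg g0; rewrite (ge0_integral_dilation a0) ?dilation_preimage_itv//.
  by rewrite ge0_integralZl_EFin ?(ltW a0)//; apply: measurable_funTS; exact: mfa.
rewrite integralE [RHS]integralE ge0_funeposM ?(ltW a0)// ge0_funenegM ?(ltW a0)//.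
congr (_ - _)%E.
- rewrite nneg//; last exact: measurable_funepos.
  by apply: eq_integral => s _; rewrite !funeposE.
- rewrite nneg//; last exact: measurable_funeneg.
  by apply: eq_integral => s _; rewrite !funenegE.
Qed.

Lemma integral_dilation_lty T a (f : R -> \bar R) : 0 < a -> a <= 1 ->
  measurable_fun setT f -> (forall s, 0 <= f s)%E ->
  (\int[mu]_(s in `[0%R, T]) f s < +oo)%E ->
  (\int[mu]_(s in `[0%R, T]) f (a * s)%R < +oo)%E.
Proof.
move=> a0 a1 mf f0 fT.
have : (\int[mu]_(s in `[0%R, (a * T)%R]) f s < +oo)%E.
  apply: le_lt_trans fT; apply: ge0_subset_integral => //.
    exact: measurable_funTS.
  move=> s /=; rewrite !in_itv/= => /andP[s0 sT]; rewrite s0/= (le_trans sT)//.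
  by rewrite ler_piMl// -(pmulr_rge0 _ a0) (le_trans s0).
have := ge0_integral_dilation a0 (measurable_itv `[0, a * T]) mf f0.
rewrite dilation_preimage_itv// => ->.
by apply: contraTT; rewrite -!leNgt !leye_eq => /eqP ->; rewrite gt0_muley// lte_fin.
Qed.

Lemma ae_dilation T a (Q : R -> Prop) : 0 < a -> a <= 1 ->
  (\forall s \ae leb_itv T, Q s) -> \forall s \ae leb_itv T, Q (a * s).
Proof.
move=> a0 a1 /leb_itv_aeP[N [mN N0 QN]]; apply/leb_itv_aeP.
have mdN : measurable (dilation a @^-1` N).
  by rewrite -[X in measurable X]setTI; exact: measurable_dilation.
exists (dilation a @^-1` N); split => //.
  have /esym/eqP := lebesgue_measure_dilation a0 mN.
  by rewrite N0 mule_eq0 eqe gt_eqF//= => /eqP.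
move=> s /not_implyP[sT Qs]; apply: QN => /= h; apply: Qs; apply: h.
move: sT; rewrite !in_itv/= => /andP[s0 sT].
by rewrite mulr_ge0 ?(ltW a0)//= (le_trans _ sT)// ler_piMl.
Qed.

End dilation.

Section rescaling.
Context {R : realType} {U H : completeNormedModType R}.
Variables (ip : inner_product H) (j : dense_embedding U H).
Variables (T r : R) (r1 : 1 < r).
Local Notation X1 := (X1 ip j T r1).
Local Notation mu := (@lebesgue_measure R).

Lemma dilation_in a s : 0 < a -> a <= 1 -> s \in `[0, T] -> a * s \in `[0, T].
Proof.
move=> a0 a1; rewrite !in_itv/= => /andP[s0 sT].
by rewrite mulr_ge0 ?(ltW a0)//= (le_trans _ sT)// ler_piMl.
Qed.

(** [u'] is the path stretched in time: on [0, T] it sees [u] on [0, a T] only. *)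
Lemma X1_rescale (a : R) (u : X1) : 0 < a -> a <= 1 ->
  exists u' : X1, (forall s, s \in `[0, T] -> X1_C u' s = X1_C u (a * s)) /\
    \forall s \ae leb_itv T, X1_path u' s = X1_path u (a * s).
Proof.
move=> a0 a1.
pose c (s : R) : dual U := if s \in `[0, T] then X1_C u (a * s) else 0.
have cP : c \in @cpath_pred R T (dual U).
  apply/mem_set; split; last by move=> t /negbTE; rewrite /c => ->.
  have /set_mem[cu _] := cpathP (X1_C u).
  have cau : {within `[0, T], continuous (fun s => X1_C u (a * s))}.
    apply/subspace_continuousP => s sT.
    have asT : `[0, T]%classic (a * s) by exact: dilation_in.
    have := (subspace_continuousP _ _).1 cu (a * s) asT; apply: cvg_trans.
    move=> V /= hV; have hW := @mulrl_continuous R a s _ hV.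
    apply: (@filterS _ (nbhs s) _ _ _ _ hW) => x h xT.
    by apply: h; exact: dilation_in.
  apply: subspace_eq_continuous cau => s /set_mem sT.
  by rewrite -[RHS]/(c s) /c ifT.
pose f (s : measurableTypeR R) : U := X1_path u (a * s).
have fP : f \in @bochner_pred _ (measurableTypeR R) R U (leb_itv T) r.
  apply/mem_set; split.
    have [h [sh hu]] := bochner_strong (Lp_repr (X1_L u)).
    exists (fun n s => h n (a * s)); split; last by move=> s; exact: hu.
    move=> n; have [fh mh] := sh n; split.
      by apply: sub_finite_set fh => _ [s _ <-]; exists (a * s).
    move=> x; rewrite [X in measurable X](_ : _ = dilation a @^-1` (h n @^-1` [set x]))//.
    by rewrite -[X in measurable X]setTI; exact: measurable_dilation.
  have mpow : measurable_fun setT (fun s : measurableTypeR R => (`|X1_path u s| `^ r)%:E).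
    apply/measurable_EFinP/(@measurableT_comp _ _ _ _ _ _ (@powR R ^~ r)) => //.
    exact: (borel_measurable_norm (X1_path_measurable u)).
  have pow0 s : (0 <= (`|X1_path u s| `^ r)%:E)%E by rewrite lee_fin powR_ge0.
  have mpowa : measurable_fun setT (fun s : measurableTypeR R => (`|f s| `^ r)%:E).
    exact: (measurableT_comp mpow (measurable_dilation a)).
  rewrite Lnorm_vecE; apply: poweR_lty; rewrite leb_itv_integral//.
  apply: (integral_dilation_lty a0 a1 mpow pow0).
  rewrite -leb_itv_integral//.
  have := bochner_fin (Lp_repr (X1_L u)); rewrite Lnorm_vecE; apply: lty_poweRy.
  by rewrite invr_eq0 gt_eqF// (lt_trans _ r1).
have vP : (CPath cP, Lp_class (BochnerFun (ltW r1) fP)) \in @X1_pred _ _ _ ip j T r r1.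
  apply/mem_set => /=.
  have h1 := ae_dilation a0 a1 (X1_CE u).
  have h2 := Lp_classK (BochnerFun (ltW r1) fP).
  have h3 : \forall s \ae leb_itv T, s \in `[0, T] by apply/leb_itv_aeP; exact: aeW.
  have h12 : \forall s \ae leb_itv T, X1_C u (a * s) = H_to_dual ip j
      (j (Lp_repr (Lp_class (BochnerFun (ltW r1) fP)) s)).
    by apply: aeS2 h1 h2 => s -> /(_ Logic.I) ->.
  by apply: aeS2 h12 h3 => s h12s sT; rewrite /c sT.
exists (MkX1 vP); split; first by move=> s sT; rewrite /X1_C/= /c sT.
by apply: aeS (Lp_classK (BochnerFun (ltW r1) fP)) => s /(_ Logic.I).
Qed.

End rescaling.

Section uniqueness.
Context {R : realType} {U H : completeNormedModType R}.
Variables (ip : inner_product H) (j : dense_embedding U H).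
Variables (T r : R) (r1 : 1 < r) (A : U -> dual U).
Hypothesis sU : separable_space U.
Hypothesis dH : dense (range (H_to_dual ip j)).
Hypothesis T0 : 0 < T.
Hypothesis mA : measurable_fun setT (A : borel U -> borel (dual U)).
Local Notation X1 := (X1 ip j T r1).
Local Notation mu := (@lebesgue_measure R).

(** [t = T] gives the pathwise equation; smaller [t] serve adaptedness. *)
Definition solves_upto (t : R) (u : X1) (y : R -> dual U) :=
  fin_L1 T (A \o X1_path u) /\
  forall s v, s \in `[0, t] ->
    X1_C u s v = y s v - \int[mu]_(tau in `[0, s]) (A (X1_path u tau) v).

Lemma solves_upto_le t t' u y : t' <= t -> solves_upto t u y -> solves_upto t' u y.
Proof.
move=> t't [L1 eq]; split => // s v; rewrite in_itv/= => /andP[s0 st'].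
by apply: eq; rewrite in_itv/= s0 (le_trans st').
Qed.

Lemma in_L1_drift (u : X1) : in_L1 T (A \o X1_path u) <-> fin_L1 T (A \o X1_path u).
Proof. by apply: in_L1P; [exact: dual_separable sU dH|exact: (drift_measurable mA)]. Qed.

Let mdrift (u : X1) (v : U) :
  measurable_fun setT (fun s : measurableTypeR R => A (X1_path u s) v).
Proof.
exact: (measurableT_comp (borel_dual_ev_measurable v) (drift_measurable mA u)).
Qed.

(* On [[0, t]] the equation is rescaled to [[0, T]], at the price of the factor
   [t / T] in front of [A]. *)
Lemma solves_upto_unique (u1 u2 : X1) (y : R -> dual U) (t : R) :
  assumptionA ip j T r1 A -> t \in `[0, T] ->
  solves_upto t u1 y -> solves_upto t u2 y ->
  forall s, s \in `[0, t] -> X1_C u1 s = X1_C u2 s.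
Proof.
(* At [t = 0] no rescaling is possible; the integral over a single point vanishes and both paths
   start at [y 0]. *)
move=> assA; rewrite in_itv/= => /andP[]; rewrite le_eqVlt => /predU1P[<- _|t0 tT].
  move=> [_ eq1] [_ eq2] s s0; apply/val_inj/funext => v /=.
  have -> : s = 0.
    by move: s0; rewrite in_itv/= => /andP[s0 s0']; apply/eqP; rewrite eq_le s0'.
  rewrite -[LHS]/(X1_C u1 0 v) -[RHS]/(X1_C u2 0 v).
  by rewrite eq1 ?eq2 ?in_itv/= ?lexx// set_itv1 !Rintegral_set1.
move=> [L1 eq1] [L2 eq2] s.
pose a := t / T.
have a0 : 0 < a by rewrite divr_gt0.
have a1 : a <= 1 by rewrite ler_pdivrMr// mul1r.
have [w1 [C1 p1]] := X1_rescale u1 a0 a1.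
have [w2 [C2 p2]] := X1_rescale u2 a0 a1.
have L1w (u w : X1) : fin_L1 T (A \o X1_path u) ->
    (\forall s \ae leb_itv T, X1_path w s = X1_path u (a * s)) ->
    in_L1 T (A \o X1_path w).
  move=> Lu pw; apply/in_L1_drift.
  have mn (z : X1) := borel_measurable_norm (drift_measurable mA z).
  have mna (z : X1) : measurable_fun setT
      (fun s : measurableTypeR R => `|A (X1_path z (a * s))|).
    exact: (measurableT_comp (mn z) (measurable_dilation a)).
  rewrite /fin_L1 (@ae_eq_integral _ _ _ mu `[0, T] (fun s => (`|A (X1_path u (a * s))|)%:E)) //.
  - apply: (integral_dilation_lty a0 a1 _ _ Lu) => //.
    by apply/measurable_EFinP; exact: mn.
  - by apply: measurable_funTS; apply/measurable_EFinP; exact: mn.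
  - by apply: measurable_funTS; apply/measurable_EFinP; exact: mna.
  - by move/leb_itv_aeP: pw; apply: aeS => z wz zT; rewrite /= wz.
have w12 : w1 = w2.
  (* Subtracting the two equations at [a * tau] and substituting in the integral gives the identity
     of (A) with factor [a]. *)
  apply: (assA a) => //; [exact: L1w p1|exact: L1w p2|].
  move=> tau v tauT.
  have atau : a * tau \in `[0, t].
    move: tauT; rewrite !in_itv/= => /andP[tau0 tauT].
    by rewrite mulr_ge0 ?(ltW a0)//= /a -mulrA ler_piMr ?(ltW t0)// ler_pdivrMl// mulr1.
  have atauT : a * tau <= T by move: atau; rewrite in_itv/= => /andP[_ /le_trans]; apply.
  rewrite C1// C2// dualB eq1// eq2//.
  have int (u : X1) : fin_L1 T (A \o X1_path u) ->
    mu.-integrable `[0, a * tau] (EFin \o (fun s => A (X1_path u s) v)).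
    move=> Lu; apply: (fin_L1_integrable (f := A \o X1_path u)) Lu atauT.
    exact: (drift_measurable mA).
  rewrite (_ : Rintegral _ _ (fun s => a * _) = \int[mu]_(s in `[0, a * tau])
     (A (X1_path u2 s) v - A (X1_path u1 s) v)); last first.
    have mdiff : measurable_fun setT (fun s : measurableTypeR R =>
        (A (X1_path u2 s) v - A (X1_path u1 s) v)%:E).
      by apply/measurable_EFinP; apply: measurable_funB; exact: mdrift.
    congr fine; rewrite (integral_dilation tau a0 mdiff).
    apply: ae_eq_integral => //.
    - apply: measurable_funTS; apply/measurable_EFinP; apply: measurable_funM => //.
      by apply: measurable_funB; exact: mdrift.
    - apply: measurable_funTS; apply: emeasurable_funM => //.
      exact: (measurableT_comp mdiff (measurable_dilation a)).
    have /leb_itv_aeP q1 := p1; have /leb_itv_aeP q2 := p2.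
    apply: aeS2 q1 q2 => z z1 z2 zt.
    have zT : z \in `[0, T].
      move: zt tauT; rewrite /= !in_itv/= => /andP[-> ztau] /andP[_ tauT].
      exact: le_trans ztau tauT.
    by rewrite z1// z2// dualB EFinM.
  rewrite RintegralB//; [ring|exact: int|exact: int].
move=> st; have sa : a^-1 * s \in `[0, T].
  move: st; rewrite !in_itv/= => /andP[s0 st].
  rewrite mulr_ge0 ?invr_ge0 ?(ltW a0)//= /a invf_div.
  by rewrite mulrAC ler_pdivrMr// ler_wpM2l// ltW.
have as_s : a * (a^-1 * s) = s by rewrite mulrA mulfV ?gt_eqF// mul1r.
by have := C1 _ sa; have := C2 _ sa; rewrite as_s w12 => <- <-.
Qed.

Lemma solves_unique (u1 u2 : X1) (y : R -> dual U) :
  assumptionA ip j T r1 A -> solves_upto T u1 y -> solves_upto T u2 y -> u1 = u2.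
Proof.
move=> assA s1 s2; apply: X1_C_inj; apply: cpath_ext => t tT.
by apply: (solves_upto_unique assA _ s1 s2) => //; rewrite in_itv/= lexx ltW.
Qed.

End uniqueness.

(** * Countably many tests *)

Lemma unit_interval_seq (R : realType) : exists q : nat -> R,
  (forall i, q i \in `[0, 1]) /\
  forall x e, x \in `[0, 1] -> 0 < e -> exists i, `|x - q i| < e.
Proof.
(* An enumeration of the rationals clamped to [0, 1]; clamping does not increase the distance to a
   point of [0, 1]. *)
exists (fun i => Num.min 1 (Num.max 0 (ratr (odflt 0 (unpickle i : option rat))))).
split=> [i|x e x01 e0].
  by rewrite in_itv/= ge_min lexx/= le_min ler01 le_max lexx.
have /rat_in_itvoo[y] : x - e < x + e by rewrite ltrD2l gtrN.
rewrite in_itv/= => /andP[y1 y2]; exists (pickle y); rewrite pickleK/=.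
move: x01; rewrite in_itv/= => /andP[x0 x1].
rewrite /Num.min /Num.max; case: ifPn => [|/negP]; case: ifPn => [|/negP];
  rewrite ltr_norml => ? ?; apply/andP; split; lra.
Qed.

Lemma residual_eq0 (V : zmodType) (x y i : V) : (x - y + i = 0) <-> (y = x + i).
Proof.
by rewrite addrAC; split=> [/eqP|->]; rewrite ?subrr// subr_eq0 => /eqP ->.
Qed.

Lemma residualB (V : zmodType) (x y i x' y' i' : V) :
  (x - y + i) - (x' - y' + i') = (x - x') - (y - y') + (i - i').
Proof.
rewrite opprD addrACA; congr (_ + _).
by rewrite !opprB addrACA [RHS]addrACA [- y + _]addrC.
Qed.

Section dense_times.
Context {R : realType} {U H : completeNormedModType R}.
Variables (ip : inner_product H) (j : dense_embedding U H).
Variables (T r : R) (r1 : 1 < r) (A : U -> dual U).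
Hypothesis T0 : 0 < T.
Hypothesis mA : measurable_fun setT (A : borel U -> borel (dual U)).
Local Notation X1 := (X1 ip j T r1).
Local Notation mu := (@lebesgue_measure R).
Variables (q : nat -> R) (c : nat -> U).
Hypothesis q01 : forall i, q i \in `[0, 1].
Hypothesis q_dense : forall x e, x \in `[0, 1] -> 0 < e -> exists i, `|x - q i| < e.
Hypothesis c_dense : forall x e, 0 < e -> exists k, `|x - c k| < e.

Let mdrift (u : X1) (v : U) :
  measurable_fun setT (fun s : measurableTypeR R => A (X1_path u s) v).
Proof.
exact: (measurableT_comp (borel_dual_ev_measurable v) (drift_measurable mA u)).
Qed.

Let drift_integrable (u : X1) v s : fin_L1 T (A \o X1_path u) -> s <= T ->
  mu.-integrable `[0, s] (EFin \o (fun s => A (X1_path u s) v)).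
Proof.
move=> Lu sT; apply: (fin_L1_integrable (f := A \o X1_path u)) Lu sT.
exact: (drift_measurable mA).
Qed.

Lemma drift_integral_lipschitz (u : X1) s v v' : fin_L1 T (A \o X1_path u) -> s <= T ->
  `|\int[mu]_(tau in `[0, s]) (A (X1_path u tau) v) -
    \int[mu]_(tau in `[0, s]) (A (X1_path u tau) v')| <=
  \int[mu]_(tau in `[0, s]) `|A (X1_path u tau)| * `|v - v'|.
Proof.
move=> Lu sT; rewrite -RintegralB//; [|exact: drift_integrable|exact: drift_integrable].
have mn := borel_measurable_norm (drift_measurable mA u).
have mT : measurable (`[0, T]%classic : set (measurableTypeR R)) by [].
have ms : measurable (`[0, s]%classic : set (measurableTypeR R)) by [].
have nintT : mu.-integrable `[0, T] (EFin \o (fun s => `|A (X1_path u s)|)).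
  apply/integrableP; split; first by apply: measurable_funTS; exact/measurable_EFinP.
  by under eq_integral do rewrite /= normr_id.
have sub : (`[0, s]%classic : set R) `<=` `[0, T].
  by move=> z /=; rewrite !in_itv/= => /andP[-> /le_trans]; apply.
have nint := integrableS mT ms sub nintT.
rewrite (_ : Rintegral _ _ _ = \int[mu]_(tau in `[0, s]) (A (X1_path u tau) (v - v'))); last first.
  by apply: eq_Rintegral => z _; rewrite linearB.
have dint := drift_integrable (v - v') Lu sT.
rewrite (le_trans (le_normr_Rintegral ms dint))//.
rewrite mulrC -RintegralZl//; apply: le_Rintegral => //.
- exact: (integrable_norm dint).
- exact: (integrableZl ms `|v - v'| nint).
- by move=> z _; rewrite mulrC dual_bound.
Qed.

Lemma path_continuous (y : cpath T (dual U)) v :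
  {within `[0, T], continuous (fun s => y s v)}.
Proof.
have /set_mem[yc _] := cpathP y.
move=> s; apply: (@continuous_comp (subspace `[0, T]) (dual U) R y (fun f : dual U => f v)).
  exact: yc.
exact: dual_ev_continuous.
Qed.

(* It suffices to test the equation against countably many times and vectors. *)
Lemma solves_upto_dense (u : X1) (y : cpath T (dual U)) t : t \in `[0, T] ->
  fin_L1 T (A \o X1_path u) ->
  (forall i k, y (t * q i) (c k) = X1_C u (t * q i) (c k) +
     \int[mu]_(s in `[0, t * q i]) (A (X1_path u s) (c k))) ->
  solves_upto A t u y.
Proof.
rewrite in_itv/= => /andP[t0 tT] Lu eq.
pose D s v := X1_C u s v - y s v + \int[mu]_(tau in `[0, s]) (A (X1_path u tau) v).
suff D0 s v : s \in `[0, t] -> D s v = 0.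
  by split => // s v /(D0 s v)/residual_eq0 ->; rewrite addrK.
have tq i : 0 <= t * q i <= t.
  by have := q01 i; rewrite in_itv/= => /andP[q0 q1]; rewrite mulr_ge0//= ler_piMr.
have Dq i w : D (t * q i) w = 0.
  have /andP[tq0 tqt] := tq i; have tqT : t * q i <= T := le_trans tqt tT.
  set s' := t * q i in tq0 tqt tqT *.
  (* A Lipschitz constant of [D s'] in the vector; the added 1 makes it positive. *)
  pose N := `|X1_C u s'| + `|y s'| + \int[mu]_(tau in `[0, s']) `|A (X1_path u tau)| + 1.
  have N0 : 0 < N.
    by rewrite ltr_wpDl// !addr_ge0// Rintegral_ge0.
  apply/eqP; rewrite -normr_le0; apply/ler_addgt0Pl => e e0; rewrite addr0.
  have [k wk] := c_dense w (divr_gt0 e0 N0).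
  have Dk : D s' (c k) = 0 by apply/residual_eq0; exact: eq.
  have -> : D s' w = (X1_C u s') (w - c k) - (y s') (w - c k) +
      (\int[mu]_(tau in `[0, s']) (A (X1_path u tau) w) -
       \int[mu]_(tau in `[0, s']) (A (X1_path u tau) (c k))).
    by rewrite -[LHS]subr0 -[X in _ - X]Dk /D residualB !linearB.
  have := drift_integral_lipschitz w (c k) Lu tqT.
  have := dual_bound (X1_C u s') (w - c k); have := dual_bound (y s') (w - c k).
  move: wk; rewrite ltr_pdivlMr// mulrC => /ltW wk b1 b2 b3.
  apply: le_trans wk; apply: le_trans (ler_normD _ _) _.
  apply: le_trans (lerD (ler_normB _ _) b3) _.
  apply: le_trans (lerD (lerD b2 b1) (lexx _)) _.
  by rewrite -!mulrDl ler_wpM2r// lerDl.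
move=> st; have : t = 0 \/ 0 < t by move: t0; rewrite le_eqVlt => /predU1P[<-|]; [left|right].
case=> [t00|tpos].
  have [i _] := q_dense (x := 0) (e := 1) ltac:(by rewrite in_itv/= lexx ler01) ltr01.
  have -> : s = t * q i; last exact: Dq.
  move: st; rewrite t00 in_itv/= mul0r => /andP[s0 s0']; apply/eqP; by rewrite eq_le s0 s0'.
have Dcont : {within `[0, T], continuous (fun s => D s v)}.
  have intc := parameterized_integral_continuous (ltW T0) (drift_integrable v Lu (lexx T)).
  move=> z; apply: cvgD; last exact: (intc z).
  by apply: cvgB; exact: path_continuous.
have sT : `[0, T]%classic s.
  by move: st; rewrite /= !in_itv/= => /andP[-> /le_trans]; apply.
apply/eqP; rewrite -normr_le0; apply/ler_addgt0Pl => e e0; rewrite addr0.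
have /(@cvgrPdist_lt _ R^o) /(_ e e0) Dnear := (subspace_continuousP _ _).1 Dcont s sT.
have /nbhs_ballP[d /= d0 dP] : nbhs s [set x | `[0, T]%classic x -> `|D s v - D x v| < e].
  exact: Dnear.
have st01 : s / t \in `[0, 1].
  move: st; rewrite !in_itv/= => /andP[s0 st].
  by rewrite divr_ge0//= ler_pdivrMr// mul1r.
have [i qi] := q_dense st01 (divr_gt0 d0 tpos).
have tqT : `[0, T]%classic (t * q i).
  by have /andP[tq0 tqt] := tq i; rewrite /= in_itv/= tq0 (le_trans tqt).
have : ball s d (t * q i).
  rewrite -ball_normE/=; have -> : s - t * q i = t * (s / t - q i).
    by rewrite mulrBr mulrCA mulfV ?gt_eqF// mulr1.
  by rewrite normrM gtr0_norm// mulrC -ltr_pdivlMr.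
by move=> /dP/(_ tqT); rewrite Dq subr0 => /ltW.
Qed.

End dense_times.

(** * The sampled driver as a Borel function of the solution *)

Section transfer.
Context {R : realType} {U H : completeNormedModType R}.
Variables (ip : inner_product H) (j : dense_embedding U H).
Variables (T r : R) (r1 : 1 < r) (A : U -> dual U).
Hypothesis sU : separable_space U.
Hypothesis dH : dense (range (H_to_dual ip j)).
Hypothesis T0 : 0 < T.
Hypothesis mA : measurable_fun setT (A : borel U -> borel (dual U)).
Hypothesis assA : assumptionA ip j T r1 A.
Local Notation X1 := (X1 ip j T r1).
Local Notation path := (cpath T (dual U)).
Local Notation mu := (@lebesgue_measure R).
Local Notation Y := {ptws nat -> R}.
Variables (q : nat -> R) (c : nat -> U).
Hypothesis q01 : forall i, q i \in `[0, 1].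
Hypothesis q_dense : forall x e, x \in `[0, 1] -> 0 < e -> exists i, `|x - q i| < e.
Hypothesis c_dense : forall x e, 0 < e -> exists k, `|x - c k| < e.

(** [k] codes a pair of indices, with (0, 0) as default for non-codes. Scaling [q] by [t] keeps all
    times in [0, t], so a sample sees the driver only up to time [t]. *)
Definition sample_time (t : R) (k : nat) : R := t * q (odflt (0, 0)%N (unpickle k)).1.
Definition sample_vector (k : nat) : U := c (odflt (0, 0)%N (unpickle k)).2.

Definition sample (t : R) (y : path) : Y :=
  fun k => y (sample_time t k) (sample_vector k).

(** The equation solved for the driver: the value it must take at the [k]-th test if [u] is a
    solution. *)
Definition driver_sample (t : R) (k : nat) (u : borel X1) : R :=
  X1_C (u : X1) (sample_time t k) (sample_vector k) +
  \int[mu]_(s in `[0, sample_time t k]) (A (X1_path (u : X1) s) (sample_vector k)).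

Lemma sample_time_in t k : t \in `[0, T] -> sample_time t k \in `[0, t].
Proof.
rewrite !in_itv/= => /andP[t0 tT]; rewrite /sample_time.
have := q01 (odflt (0, 0)%N (unpickle k)).1; rewrite in_itv/= => /andP[q0 q1].
by rewrite mulr_ge0//= ler_piMr.
Qed.

Lemma sample_time_inT t k : t \in `[0, T] -> sample_time t k \in `[0, T].
Proof.
move=> tT; have := sample_time_in k tT; move: tT; rewrite !in_itv/=.
by move=> /andP[_ tT] /andP[-> /le_trans]; apply.
Qed.

Lemma sample_solves t (u : X1) (y : path) : t \in `[0, T] ->
  fin_L1 T (A \o X1_path u) ->
  (forall k, (sample t y : nat -> R) k = driver_sample t k u) -> solves_upto A t u y.
Proof.
move=> tT Lu h; apply: (solves_upto_dense T0 mA q01 q_dense c_dense tT Lu) => i k.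
have := h (pickle (i, k)).
by rewrite /sample /driver_sample /sample_time /sample_vector pickleK.
Qed.

Lemma driver_sample_measurable t k : t \in `[0, T] ->
  measurable_fun setT (driver_sample t k).
Proof.
move=> tT; have skT := sample_time_inT k tT.
apply: measurable_funD.
  apply: continuous_measurable_borel.
  exact: (@X1_ev_continuous _ _ _ ip j T r r1 _ (sample_vector k) skT).
apply: measurable_drift_integral => //.
by move: skT; rewrite in_itv/= => /andP[].
Qed.

Lemma sample_measurable d (S : measurableType d) (V : S -> borel path) t k :
  t \in `[0, T] -> measurable_fun setT V ->
  measurable_fun setT (fun w => (sample t (V w) : nat -> R) k).
Proof.
move=> tT mV; have skT := sample_time_inT k tT.
have cev : continuous (fun y : path => y (sample_time t k) (sample_vector k)).
  move=> y; apply: (@continuous_comp path (dual U) R (fun y : path => y (sample_time t k))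
    (fun f : dual U => f (sample_vector k))); first exact: cpath_ev_continuous.
  exact: dual_ev_continuous.
exact: (measurableT_comp (continuous_measurable_borel cev) mV).
Qed.

Lemma sample_separates (u1 u2 : X1) :
  (forall k, X1_C u1 (sample_time T k) (sample_vector k) =
             X1_C u2 (sample_time T k) (sample_vector k)) -> u1 = u2.
Proof.
move=> h; have TT : T \in `[0, T] by rewrite in_itv/= lexx ltW.
pose A0 (_ : U) : dual U := 0.
have int0 v s : \int[mu]_(tau in `[0, s]) (A0 (X1_path u1 tau) v) = 0.
  by rewrite /Rintegral integral0_eq.
(* the equation with zero drift expresses equality of the two paths *)
have mA0 : measurable_fun setT (A0 : borel U -> borel (dual U)) by exact: measurable_cst.
have L0 : fin_L1 T (A0 \o X1_path u1).
  rewrite /fin_L1 (eq_integral (cst 0%E)) ?integral0 ?ltry// => s _.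
  by rewrite /= normr0.
have eq0 i k : X1_C u2 (T * q i) (c k) = X1_C u1 (T * q i) (c k) +
    \int[mu]_(s in `[0, T * q i]) (A0 (X1_path u1 s) (c k)).
  have := h (pickle (i, k)); rewrite /sample_time /sample_vector pickleK/= => ->.
  by rewrite (int0 (c k)); exact: (esym (addr0 _)).
have [_ eq] := solves_upto_dense T0 mA0 q01 q_dense c_dense TT L0 eq0.
apply: X1_C_inj; apply: cpath_ext => s sT; apply/val_inj/funext => v.
have := eq s v sT; rewrite (int0 v) => e; exact: (etrans e (subr0 _)).
Qed.

Section given_solution.
Context d' (Omega' : measurableType d') (P' : probability Omega' R).
Variables (u' : {RV P' >-> borel X1}) (V' : {RV P' >-> borel path}).
Hypothesis sol' : is_solution A u' V'.

Lemma solution_sample t : t \in `[0, T] ->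
  {ae P', forall w, fin_L1 T (A \o X1_path (u' w : X1)) /\
    forall k, (sample t (V' w) : nat -> R) k = driver_sample t k (u' w)}.
Proof.
move=> tT; case: sol' => _ aeL1 aeq.
have aek : {ae P', forall w, forall k,
    (sample t (V' w) : nat -> R) k = driver_sample t k (u' w)}.
  apply/ae_foralln => k.
  apply: aeS (aeq _ (sample_vector k) (sample_time_inT k tT)) => w.
  by rewrite /driver_sample => ->; rewrite subrK.
by apply: aeS2 aeL1 aek => w Lw eqw; split => //; exact/(in_L1_drift sU dH mA).
Qed.

Lemma solution_solves : {ae P', forall w, solves_upto A T (u' w) (V' w : path)}.
Proof.
have TT : T \in `[0, T] by rewrite in_itv/= lexx ltW.
by apply: aeS (solution_sample TT) => w [Lw]; exact: sample_solves.
Qed.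

Lemma solution_exhaustion (K : nat -> set X1) t :
  t \in `[0, T] -> (forall n, compact (K n)) ->
  {ae P', forall w, exists n, K n (u' w)} ->
  exists F : nat -> set (X1 * Y), [/\ forall i, closed (F i),
    forall i x y, F i (x, sample t y) -> solves_upto A t x y,
    forall i, exists m, F i `<=` fst @^-1` K m &
    {ae P', forall w, exists i, F i (u' w, sample t (V' w))}].
Proof.
move=> tT cK aeK.
have TT : T \in `[0, T] by rewrite in_itv/= lexx ltW.
have aeM : {ae P', forall w, [/\ exists n, K n (u' w),
    fin_L1 T (A \o X1_path (u' w : X1)) &
    forall k, (sample t (V' w) : nat -> R) k = driver_sample t k (u' w)]}.
  by apply: aeS2 aeK (solution_sample tT) => w Kw [].
(* The functions separating the points of [X1] are sampled up to [T] whatever [t] is; only the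
   driver is sampled up to [t]. *)
have [F [cF FB FK aeF]] := @graph_exhaustion _ _ _ P' X1
  (fun k u => X1_C u (sample_time T k) (sample_vector k))
  (fun k => @X1_ev_continuous _ _ _ ip j T r r1 _ (sample_vector k) (sample_time_inT k TT))
  sample_separates u' (fun w => sample t (V' w)) (measurable_funPT _)
  (fun k => sample_measurable k tT (measurable_funPT _))
  K _ (driver_sample t) cK (measurable_fin_L1_drift sU mA)
  (fun k => driver_sample_measurable k tT) aeM.
exists F; split => // i x y /FB[Lx eqx].
exact: sample_solves.
Qed.

End given_solution.

End transfer.

(** * Transfer of the solution *)

Section reached.
Context {R : realType} {X : topologicalType}.
Local Notation Y := {ptws nat -> R}.
Variable F : nat -> set (X * Y).

(** The projection to sampled drivers of the part of the [F i] over [Q]. Where solutions are unique,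
    it is the preimage of [Q] under the inverse map from drivers to solutions. *)
Definition reached (Q : set X) : set Y :=
  [set eta | exists i x, Q x /\ F i (x, eta)].

(** Each closed piece lies over a compact, so its projection is closed, and [closed_ptws_measurable]
    applies to any [S] that measures the coordinates of [eta]. *)
Lemma reached_measurable (K : nat -> set X) (Omega : Type) (S : set_system Omega)
    (eta : Omega -> Y) (Q : set X) :
  (forall n, compact (K n)) -> (forall i, closed (F i)) ->
  (forall i, exists m, F i `<=` fst @^-1` K m) -> closed Q ->
  sigma_algebra setT S ->
  (forall k a b, S [set w | a < (eta w : nat -> R) k < b]) ->
  S (eta @^-1` reached Q).
Proof.
move=> cK cF FK cQ sS mS.
have -> : eta @^-1` reached Q =
    \bigcup_i (eta @^-1` [set y | exists2 x, Q x & F i (x, y)]).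
  by apply/seteqP; split=> w [i]; [move=> [x [Qx Fx]]|move=> _ [x Qx Fx]];
    exists i => //; exists x.
case: (sS) => _ _; apply => i; apply: (closed_ptws_measurable sS mS).
have [m Fm] := FK i.
have cFQ : closed (F i `&` fst @^-1` Q).
  by apply: closedI => //; apply: preimage_closed cQ => z _; exact: cvg_fst.
have := compact_projection (cK m) cFQ.
congr (closed _); apply/seteqP; split=> y [x]; first by move=> _ [Fx Qx]; exists x.
by move=> Qx Fx; exists x => //; exact: (Fm (x, y)).
Qed.

End reached.

Lemma measurable_sigma_algebra d (S : measurableType d) :
  sigma_algebra setT (measurable : set_system S).
Proof.
split; [exact: measurable0|by move=> B mB; rewrite setTD; exact: measurableC|].
by move=> B mB; apply: bigcupT_measurable.
Qed.

Lemma measurable_between d (S : measurableType d) (R : realType) (f : S -> R) a b :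
  measurable_fun setT f -> measurable [set w | a < f w < b].
Proof.
move=> mf; rewrite [X in measurable X](_ : _ = f @^-1` `]a, b[).
  by rewrite -[X in measurable X]setTI; apply: mf.
by apply/seteqP; split=> w /=; rewrite in_itv.
Qed.

Lemma measurable_fun_RV d d' (Omega : measurableType d) (S : measurableType d')
    (R : realType) (P : probability Omega R) (f : Omega -> S) :
  measurable_fun setT f -> exists u : {RV P >-> S}, forall w, u w = f w.
Proof.
move=> mf.
pose u : {mfun Omega >-> S} := HB.pack f (isMeasurableFun.Build _ _ _ _ f mf).
by exists u.
Qed.

Unset Implicit Arguments.

Theorem theorem1p18 (R : realType) (U H : completeNormedModType R)
  (ip : inner_product H) (j : dense_embedding U H)
  (T r : R) (r1 : 1 < r) (A : U -> dual U)
  (separable_U : separable_space U)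
  (dense_H : dense (range (H_to_dual ip j)))
  (T_gt0 : 0 < T)
  (* A is a Borel map: needed for the almost sure statements about A(u) *)
  (measurable_A : measurable_fun setT (A : borel U -> borel (dual U)))
  (assA : assumptionA ip j T r1 A)
  (d' : measure_display) (Omega' : measurableType d')
  (P' : probability Omega' R)
  (u' : {RV P' >-> borel (X1 ip j T r1)})
  (V' : {RV P' >-> borel (cpath T (dual U))})
  (sol' : is_solution A u' V')
  (d : measure_display) (Omega : measurableType d) (P : probability Omega R)
  (V : {RV P >-> borel (cpath T (dual U))})
  (eq_law : forall B : set (borel (cpath T (dual U))), measurable B ->
    distribution P V B = distribution P' V' B) :
  exists u : {RV P >-> borel (X1 ip j T r1)},
    [/\ sigma_compact_range u,
        is_solution A u V,
        (forall u2 : {RV P >-> borel (X1 ip j T r1)},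
          sigma_compact_range u2 -> is_solution A u2 V ->
          {ae P, forall w, u2 w = u w}) &
        adapted (augmented_filtration V) u].
Proof.
have [q [q01 q_dense]] := unit_interval_seq R.
have [c c_dense] := separable_seq separable_U.
have [[S' [[K [cK S'E]] aeS']] _ _] := sol'.
have aeK : {ae P', forall w, exists n, K n (u' w)}.
  by apply: aeS aeS' => w; rewrite S'E => -[n _ Kn]; exists n.
have TT : T \in `[0, T] by rewrite in_itv/= lexx ltW.
pose samp t (y : cpath T (dual U)) := sample q c t y.
(* The family at time [T] builds [u]; those at the other times give adaptedness. *)
have /choice[F FP] : forall t, exists F : nat -> set (X1 ip j T r1 * {ptws nat -> R}),
    t \in `[0, T] -> [/\ forall i, closed (F i),
    forall i x y, F i (x, samp t y) -> solves_upto A t x y,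
    forall i, exists m, F i `<=` fst @^-1` K m &
    {ae P', forall w, exists i, F i (u' w, samp t (V' w))}].
  move=> t; have [tT|tT] := boolP (t \in `[0, T]); last by exists (fun=> set0).
  have [F hF] := solution_exhaustion separable_U dense_H T_gt0 measurable_A
    q01 q_dense c_dense sol' tT cK aeK.
  by exists F.
have samp_mes d1 (S1 : measurableType d1) (W : S1 -> borel (cpath T (dual U))) t k a b :
    t \in `[0, T] -> measurable_fun setT W ->
    measurable [set w | a < (samp t (W w) : nat -> R) k < b].
  move=> tT mW; apply: measurable_between.
  exact: (sample_measurable c q01 k tT mW).
have reached_mes d1 (S1 : measurableType d1) (W : S1 -> borel (cpath T (dual U))) t Q :
    t \in `[0, T] -> measurable_fun setT W -> closed Q ->
    measurable [set w | reached (F t) Q (samp t (W w))].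
  move=> tT mW cQ; have [cF _ FK _] := FP t tT.
  apply: (@reached_measurable _ _ (F t) K S1 measurable (fun w => samp t (W w))) => //.
    exact: measurable_sigma_algebra.
  by move=> k a b; exact: samp_mes.
have ae_reached t : t \in `[0, T] -> {ae P, forall w, reached (F t) setT (samp t (V w))}.
  move=> tT; have [_ _ _ aeF] := FP t tT.
  have mW := @reached_mes _ (borel (cpath T (dual U))) id t setT tT (@measurable_id _ _ _) closedT.
  (* [W] is a Borel set of paths of full measure under the law of [V'], hence under that of [V]. *)
  pose W : set (borel (cpath T (dual U))) := [set y | reached (F t) setT (samp t y)].
  have PW : P (V @^-1` (~` W)) = 0%E.
    have := eq_law _ (measurableC mW); rewrite /distribution /pushforward => ->.
    apply/(@negligibleP _ _ _ P').
      rewrite -[X in measurable X]setTI.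
      by apply: (measurable_funPT V') => //; exact: measurableC.
    by apply: negligibleS aeF => w /= nr [i Fi]; apply: nr; exists i, (u' w).
  exists (V @^-1` (~` W)); split => //.
  rewrite -[X in measurable X]setTI.
  by apply: (measurable_funPT V) => //; exact: measurableC.
pose E := [set w | reached (F T) setT (samp T (V w))].
pose x0 : X1 ip j T r1 := point.
(* On [E] uniqueness leaves a single candidate; off [E] the value is the default [x0]. *)
pose sel (w : Omega) : X1 ip j T r1 :=
  xget x0 [set x | exists i, F T i (x, samp T (V w))].
have [cF Fsol FK aeF] := FP T TT.
have selE w : E w -> exists i, F T i (sel w, samp T (V w)).
  move=> [i [x [_ Fx]]]; rewrite /sel; case: xgetP => [y _ //|/(_ x)[]].
  by exists i.
have sel_solves w : E w -> solves_upto A T (sel w) (V w).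
  by move=> /selE[i /Fsol].
have selN w : ~ E w -> sel w = x0.
  move=> nE; rewrite /sel; case: xgetP => // x _ [i Fx].
  by case: nE; exists i, x.
have sel_uniq w x : E w -> solves_upto A T x (V w) -> sel w = x.
  move=> /sel_solves; exact: (solves_unique separable_U dense_H T_gt0 measurable_A assA).
have msel : measurable_fun setT (sel : Omega -> borel (X1 ip j T r1)).
  apply: measurable_fun_borel => C cC.
  (* By uniqueness, on [E] the selected path lies in [C] as soon as some path of [C] is paired with
     the driver in an [F T i]. *)
  have -> : sel @^-1` C = [set w | reached (F T) C (samp T (V w))] `|`
      (~` E `&` (cst x0 @^-1` C)).
    apply/seteqP; split=> [w Cw|w [[i [x [Cx Fx]]]|[nE /= Cx0]]].
    - have [Ew|nE] := pselect (E w); last by right; split => //=; rewrite -(selN w nE).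
      by have [i Fi] := selE w Ew; left; exists i, (sel w).
    - have Ew : E w by exists i, x.
      by rewrite /= (sel_uniq w x Ew (Fsol _ _ _ Fx)).
    - by rewrite /= selN.
  apply: measurableU; first by apply: reached_mes => //; exact: measurable_funPT.
  apply: measurableI.
    by apply: measurableC; apply: reached_mes.
  by rewrite preimage_cst; case: ifP.
have [u uE] := measurable_fun_RV P msel.
have u_range : sigma_compact_range u.
  (* The point [x0] is added so that every value of [u], not just almost every one, lies in one of
     the compacts. *)
  pose K2 n := if n is m.+1 then K m else [set x0].
  exists (\bigcup_n K2 n); split.
    exists K2; split => // -[|n]; [exact: compact_set1|exact: cK].
  move=> _ [w _ <-]; rewrite uE; have [Ew|nE] := pselect (E w).
    have [i Fi] := selE w Ew; have [m Fm] := FK i.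
    by exists m.+1 => //; exact: (Fm _ Fi).
  by exists 0%N => //; rewrite selN.
exists u; split => //.
- split.
  + have [S [sS uS]] := u_range; exists S; split => //.
    by apply: aeW => w; apply: uS; exists w.
  + apply: aeS (ae_reached T TT) => w Ew.
    rewrite uE; apply/(in_L1_drift separable_U dense_H measurable_A).
    exact: (sel_solves w Ew).1.
  + move=> t v tT; apply: aeS (ae_reached T TT) => w Ew.
    by rewrite uE; exact: (sel_solves w Ew).2.
- move=> u2 _ sol2.
  apply: aeS2 (ae_reached T TT) (solution_solves separable_U dense_H T_gt0
    measurable_A q01 q_dense c_dense sol2) => w Ew /(sel_uniq w _ Ew) <-.
  by rewrite uE.
move=> t tT B mB; rewrite /augmented_filtration.
rewrite (_ : (fun w => X1_C (u w) t) = fun w => X1_C (sel w) t); last first.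
  by apply/funext => w; rewrite uE.
set G := (X in <<s X >>).
suff mut : measurable_fun setT
    ((fun w => X1_C (sel w) t) : g_sigma_algebraType G -> borel (dual U)).
  by have := mut measurableT B mB; rewrite setTI.
have [cFt Ftsol FtK aeFt] := FP t tT.
apply: measurable_fun_borel => C cC.
pose Q : set (X1 ip j T r1) := [set x | C (X1_C x t)].
have cQ : closed Q.
  apply: (@preimage_closed _ _ (fun x : X1 ip j T r1 => X1_C x t)) cC => x _.
  apply: (@continuous_comp (X1 ip j T r1) (cpath T (dual U)) (dual U) (@X1_C _ _ _ ip j T r r1)
    (fun y : cpath T (dual U) => y t)); first exact: X1_C_continuous.
  exact: cpath_ev_continuous.
have tt : t \in `[0, t] by move: tT; rewrite !in_itv/= lexx => /andP[->].
have tleT : t <= T by move: tT; rewrite in_itv/= => /andP[].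
(* On [E] and [Et], [u] is determined up to time [t] by [samp t V]. *)
pose Et := [set w | reached (F t) setT (samp t (V w))].
have reachedP w : E w -> Et w ->
    C (X1_C (sel w) t) <-> reached (F t) Q (samp t (V w)).
  move=> Ew [i [x [_ Fx]]].
  have same k y : F t k (y, samp t (V w)) -> X1_C (sel w) t = X1_C y t.
    move=> Fy; apply: (solves_upto_unique separable_U dense_H T_gt0 measurable_A
      assA tT (solves_upto_le tleT (sel_solves w Ew)) (Ftsol _ _ _ Fy) tt).
  split=> [Cu|[k [y [Qy Fy]]]]; first by exists i, x; rewrite /Q/= -(same i x Fx).
  by rewrite (same k y Fy).
have mE : measurable (E `&` Et) by apply: measurableI; apply: reached_mes.
have PN : P (~` (E `&` Et)) = 0%E.
  apply/(@negligibleP _ _ _ P); first exact: measurableC.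
  rewrite setCI; apply: negligibleU; [exact: (ae_reached T TT)|exact: (ae_reached t tT)].
have null_G N : measurable N -> P N = 0%E -> <<s G >> N.
  by move=> mN N0; apply: sub_sigma_algebra; right.
have reached_G : <<s G >> [set w | reached (F t) Q (samp t (V w))].
  apply: (@reached_measurable _ _ (F t) K Omega <<s G >> (fun w => samp t (V w))) => //.
  (* The sampling times do not exceed [t], so each coordinate is a Borel function of some [V s] with
     [s] in [0, t]. *)
  move=> k a b; apply: sub_sigma_algebra; left.
  exists (sample_time q t k); first exact: (sample_time_in q01 k tT).
  exists [set f : dual U | a < f (sample_vector c k) < b]; last by rewrite setTI.
  apply: (@measurable_between _ (borel (dual U))).
  exact: borel_dual_ev_measurable.
have -> : (fun w => X1_C (sel w) t) @^-1` C =
    ([set w | reached (F t) Q (samp t (V w))] `&` (E `&` Et)) `|`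
    ((fun w => X1_C (sel w) t) @^-1` C `&` ~` (E `&` Et)).
  apply/seteqP; split=> [w Cw|w [[rw [Ew Etw]]|[]//]].
    have [EEt|nEEt] := pselect ((E `&` Et) w); last by right.
    by left; split => //; apply/reachedP => //; case: EEt.
  exact/(reachedP w Ew Etw).
(* The augmentation adds measurable null sets; this remainder is measurable because [sel] is
   Borel. *)
have mCQ : measurable ((fun w => X1_C (sel w) t) @^-1` C `&` ~` (E `&` Et)).
  apply: measurableI; last exact: measurableC.
  rewrite -[X in measurable X]setTI.
  exact: (msel measurableT _ (closed_borel cQ)).
apply: measurableU; last first.
  apply: null_G => //; apply: (subset_measure0 _ _ (@subIsetr _ _ _) PN) => //.
  exact: measurableC.
apply: measurableI; first exact: reached_G.
rewrite -[E `&` Et]setCK; apply: measurableC; apply: null_G => //.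
exact: measurableC.
Qed.
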